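(* Let $\mathcal{H}$ be the Hilbert space described in the context and let $\mu$ be a Borel probability measure on $\mathcal{H}$. Assume there are constants $\gamma,c,C>0$ such that for all $d\ge1$, $$\mu\Big(\Big\{x:\sum_{j=d+1}^\infty \frac{1}{\lambda_j} \langle x,\psi_j\rangle_{L^2}^2 >0\Big\} \Big)\leq C\exp(-c d^{\gamma}).$$ Let $X_1,\dots,X_n$ be i.i.d. with law $\mu$. Then for all $\epsilon>0$, $$\mathbb{P}\left(\sup_{(\theta,t)\in \mathcal{H} \times \mathbb{R}}\frac{|F_{\theta}(t)-F_{\theta,n}(t)|}{\sqrt{F_\theta(t)\vee F_{\theta,n}(t)}}\ge \epsilon \right)\le Ce^{C\log(2n+1)^{1+\frac{1}{\gamma}}-c n\epsilon^2},$$ where $c>0$ is an absolute constant and $C>0$ depends on $\gamma$.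
   Context: Let $(\Omega,m)$ be a measure space, $(\psi_j)_{j\ge1}$ an orthonormal basis of $L^2(\Omega,m)$ with inner product $\langle\cdot,\cdot\rangle_{L^2}$, and $(\lambda_j)_{j\ge1}$ a non-increasing sequence of positive numbers converging to $0$. Let $\mathcal{H}=\{f\in L^2(\Omega,m):\sum_j\langle f,\psi_j\rangle_{L^2}^2/\lambda_j<\infty\}$ with inner product $\langle f,g\rangle_{\mathcal{H}}=\sum_j\lambda_j^{-1}\langle f,\psi_j\rangle_{L^2}\langle g,\psi_j\rangle_{L^2}$. For $\theta\in\mathcal{H}$ and $t\in\mathbb{R}$, $F_\theta(t)=\mu(\{x:\langle x,\theta\rangle_{\mathcal{H}}\le t\})$ and $F_{\theta,n}(t)=\mu_n(\{x:\langle x,\theta\rangle_{\mathcal{H}}\le t\})$, where $\mu_n=\frac1n\sum_{j=1}^n\delta_{X_j}$.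
   Formalization: The constant C in the final bound is allowed to depend on γ and also on the constants c and C of the tail assumption; dependence on γ alone is impossible (take μ uniform on D ≥ 4n orthogonal vectors of H). *)

(* Defs.v *)
From HB Require Import structures.
From mathcomp Require Import all_boot all_order all_algebra.
From mathcomp Require Import all_classical all_reals all_analysis.

Set Implicit Arguments.
Unset Strict Implicit.
Unset Printing Implicit Defensive.

Import Order.TTheory GRing.Theory Num.Theory.
Import numFieldNormedType.Exports.

Local Open Scope classical_set_scope.
Local Open Scope ring_scope.

(* Basis index j >= 1 of the paper corresponds to index j-1 : nat here.      *)

Section L2.
Context {d : measure_display} {Omega : measurableType d} {R : realType}.
Variable m : {measure set Omega -> \bar R}.

Definition inL2 (f : Omega -> R) : Prop :=
  measurable_fun setT f /\ (\int[m]_x ((f x) ^+ 2)%:E < +oo)%E.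

Definition ipL2 (f g : Omega -> R) : R := Rintegral m setT (fun x => f x * g x).

Definition ONB (psi : nat -> Omega -> R) : Prop :=
  [/\ forall j, inL2 (psi j),
      forall i j, ipL2 (psi i) (psi j) = (i == j)%:R &
      forall f, inL2 f -> (forall j, ipL2 f (psi j) = 0) ->
        {ae m, forall x, f x = 0}].

End L2.

Definition eigen_seq {R : realType} (lam : nat -> R) : Prop :=
  [/\ forall j, 0 < lam j,
      forall i j, (i <= j)%N -> lam j <= lam i &
      lam @ \oo --> 0].

Section Hspace.
Context {d : measure_display} {Omega : measurableType d} {R : realType}.
Variables (m : {measure set Omega -> \bar R}) (psi : nat -> Omega -> R)
  (lam : nat -> R).

Definition coef (f : Omega -> R) (j : nat) : R := ipL2 m f (psi j).

Definition inH (f : Omega -> R) : Prop :=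
  inL2 m f /\ cvgn (series (fun j => coef f j ^+ 2 / lam j)).

Definition ipHf (f g : Omega -> R) : R :=
  limn (series (fun j => (lam j)^-1 * coef f j * coef g j)).

Definition Htype := {f : Omega -> R | inH f}.

Lemma inH0 : inH (fun _ => 0).
Proof.
split.
  split; first exact: measurable_cst.
  under eq_integral do rewrite expr0n /=.
  by rewrite integral0 ltry.
have c0 j : coef (fun _ => 0) j = 0.
  rewrite /coef /ipL2.
  rewrite /Rintegral.
  under eq_integral do rewrite mul0r.
  by rewrite integral0.
under [X in series X]funext do rewrite c0 expr0n /= mul0r.
apply/cvg_ex; exists 0.
rewrite (_ : series _ = fun _ => 0); first exact: cvg_cst.
by apply/funext => n; rewrite /series /= big1.
Qed.

Definition H0 : Htype := exist _ (fun _ => 0) inH0.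

End Hspace.

HB.instance Definition _ {d : measure_display} {Omega : measurableType d}
  {R : realType} (m : {measure set Omega -> \bar R}) psi (lam : nat -> R) :=
  gen_eqMixin (Htype m psi lam).
HB.instance Definition _ {d : measure_display} {Omega : measurableType d}
  {R : realType} (m : {measure set Omega -> \bar R}) psi (lam : nat -> R) :=
  gen_choiceMixin (Htype m psi lam).
HB.instance Definition _ {d : measure_display} {Omega : measurableType d}
  {R : realType} (m : {measure set Omega -> \bar R}) psi (lam : nat -> R) :=
  isPointed.Build (Htype m psi lam) (H0 m psi lam).

Section Hborel.
Context {d : measure_display} {Omega : measurableType d} {R : realType}.
Variables (m : {measure set Omega -> \bar R}) (psi : nat -> Omega -> R)
  (lam : nat -> R).

Local Notation H := (Htype m psi lam).

Definition ipH (x y : H) : R := ipHf m psi lam (proj1_sig x) (proj1_sig y).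

Definition distH (x y : H) : R :=
  Num.sqrt (ipHf m psi lam (proj1_sig x \- proj1_sig y)
                           (proj1_sig x \- proj1_sig y)).

Definition openH : set (set H) :=
  [set U | forall x, U x -> exists2 r : R, 0 < r &
             forall y, distH x y < r -> U y].

Definition Hborel := g_sigma_algebraType openH.

Definition Fth (mu : probability Hborel R) (theta : H) (t : R) : R :=
  fine (mu [set x : Hborel | ipH x theta <= t]).

Definition Fthn {n : nat} (Xs : 'I_n -> H) (theta : H) (t : R) : R :=
  #|[set i : 'I_n | ipH (Xs i) theta <= t]|%:R / n%:R.

(* the tail event {x : sum_{j >= d+1} lam_j^{-1} <x,psi_j>^2 > 0}
   (1-indexed j >= dd+1 is 0-indexed k >= dd) *)
Definition tail_pos (dd : nat) : set Hborel :=
  [set x | 0 < limn (series (fun k =>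
              (lam (k + dd)%N)^-1 * coef m psi (proj1_sig x) (k + dd)%N ^+ 2))].

Definition iid_law {d' : measure_display} {T : measurableType d'} {n : nat}
  (P : probability T R) (mu : probability Hborel R) (X : 'I_n -> T -> Hborel)
  : Prop :=
  (forall i, measurable_fun setT (X i)) /\
  forall B : 'I_n -> set Hborel, (forall i, measurable (B i)) ->
    fine (P (\bigcap_(i in [set: 'I_n]) (X i @^-1` B i))) =
    \prod_(i < n) fine (mu (B i)).

Definition sup_stat {d' : measure_display} {T : measurableType d'} {n : nat}
  (mu : probability Hborel R) (X : 'I_n -> T -> Hborel) (omega : T) : R :=
  sup [set r : R | exists (theta : H) (t : R),
        r = `|Fth mu theta t - Fthn (fun i => X i omega) theta t| /
            Num.sqrt (Num.max (Fth mu theta t) (Fthn (fun i => X i omega) theta t))].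

End Hborel.

Definition outer_le {d' : measure_display} {T : measurableType d'} {R : realType}
  (P : probability T R) (E : set T) (b : R) : Prop :=
  exists A : set T, [/\ measurable A, E `<=` A & (P A <= b%:E)%E].

(* Main.v *)
(* Only countably many half-spaces, with finitely supported rational normals and
   rational thresholds, are needed: every half-space indicator is a pointwise
   limit of theirs. For finitely many half-spaces the deviation depends on the
   sample only through an i.i.d. code with values in a finite set, so the
   relative Vapnik-Chervonenkis inequality (ghost sample, random swaps, Hoeffding)
   is a statement about finite sums.

   The class has infinite VC dimension, but the inequality only involves the
   expected number of traces on the double sample. Call a point good when its
   coordinates of index at least D vanish, and let p be the probability of a bad
   point. By Pajor's lemma half-spaces cut out at most (2n+1)^(D+1) 2^#bad traces,
   whose expectation is at most (2n+1)^(D+1) (1+p)^(2n). With D of order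
   (log(2n+1)/c)^(1/gamma) one has p <= C/(2n+1), so the second factor is at most
   e^C and the first is exp(O(log(2n+1)^(1+1/gamma))). *)

Require Import Defs.
From HB Require Import structures.
From mathcomp Require Import all_boot all_order all_algebra.

Import Order.TTheory GRing.Theory Num.Theory.
Local Open Scope ring_scope.

(** * Traces of half-spaces *)

Definition shattered {J : finType} (F : {set {set J}}) : {set {set J}} :=
  [set Z : {set J} | [forall Y : {set J}, (Y \subset Z) ==> [exists A in F, A :&: Z == Y]]].

Lemma shatteredP (J : finType) (F : {set {set J}}) (Z : {set J}) :
  reflect (forall Y : {set J}, Y \subset Z -> exists2 A, A \in F & A :&: Z = Y)
          (Z \in shattered F).
Proof.
rewrite inE; apply: (iffP forallP) => [h Y YZ|h Y].
  by have /implyP/(_ YZ)/exists_inP[A AF /eqP] := h Y; exists A.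
by apply/implyP => /h[A AF <-]; apply/exists_inP; exists A.
Qed.

Lemma shatteredS (J : finType) (F : {set {set J}}) (Z W : {set J}) :
  W \subset Z -> Z \in shattered F -> W \in shattered F.
Proof.
move=> WZ /shatteredP sZ; apply/shatteredP => Y YW.
have [A AF AZ] := sZ Y (subset_trans YW WZ).
exists A => //; apply/setP => x; move/setP/(_ x): AZ; rewrite !inE.
have /implyP := subsetP WZ x; have /implyP := subsetP YW x.
by case: (x \in A); case: (x \in Z); case: (x \in W); case: (x \in Y).
Qed.

Lemma shattered_mono (J : finType) (F G : {set {set J}}) :
  F \subset G -> shattered F \subset shattered G.
Proof.
move=> /subsetP FG; apply/subsetP => Z /shatteredP sZ; apply/shatteredP => Y /sZ[A AF <-].
by exists A => //; exact: FG.
Qed.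

(* Pajor's strengthening of the Sauer-Shelah lemma: split the family along a
   point [x] separating two members; a set shattered by both halves can be
   enlarged by [x]. *)
Lemma pajor (J : finType) (F : {set {set J}}) : (#|F| <= #|shattered F|)%N.
Proof.
have [k] := ubnP #|F|; elim: k => // k IH in F *; rewrite ltnS => Fk.
have [->|[A0 A0F]] := set_0Vmem F; first by rewrite cards0.
have sh0 : set0 \in shattered F.
  apply/shatteredP => Y; rewrite subset0 => /eqP ->.
  by exists A0; rewrite ?setI0.
have [F1|] := leqP #|F| 1.
  by rewrite (leq_trans F1)// card_gt0; apply/set0Pn; exists set0.
move=> /card_gt1P[A [B [AF BF AB]]].
have [x xAB] : exists x, (x \in A) != (x \in B).
  apply/existsP; apply: contraNT AB; rewrite negb_exists => /forallP h.
  by apply/eqP/setP => x; have := h x; rewrite negbK => /eqP.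
pose F0 := [set D in F | x \notin D]; pose F1 := [set D in F | x \in D].
have F10 : F = F0 :|: F1 by apply/setP => D; rewrite !inE -andb_orr orNb andbT.
have dis : F0 :&: F1 = set0.
  by apply/setP => D; rewrite !inE; case: (x \in D); rewrite ?andbF.
have cF : #|F| = (#|F0| + #|F1|)%N by rewrite F10 cardsU dis cards0 subn0.
have [F0p F1p] : (0 < #|F0|)%N /\ (0 < #|F1|)%N.
  split; rewrite card_gt0; apply/set0Pn.
    by move: xAB; case xA : (x \in A); case xB : (x \in B) => // _;
      [exists B | exists A]; rewrite inE ?AF ?BF ?xA ?xB.
  by move: xAB; case xA : (x \in A); case xB : (x \in B) => // _;
    [exists A | exists B]; rewrite inE ?AF ?BF ?xA ?xB.
have I0 : (#|F0| <= #|shattered F0|)%N.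
  by apply: IH; apply: leq_trans Fk; rewrite cF -addn1 leq_add2l.
have I1 : (#|F1| <= #|shattered F1|)%N.
  by apply: IH; apply: leq_trans Fk; rewrite cF -add1n leq_add2r.
rewrite cF (leq_trans (leq_add I0 I1))// -cardsUI.
(* No set shattered by [F0] or by [F1] contains [x]. Hence adjoining [x] is injective on the sets
   shattered by both halves, and its image [Q] is disjoint from the sets shattered by one of
   them. *)
pose Q := [set x |: Z | Z in shattered F0 :&: shattered F1].
have nx0 Z : Z \in shattered F0 -> x \notin Z.
  move=> /shatteredP /(_ [set x]); rewrite sub1set => h.
  apply/negP => xZ; have [D] := h xZ; rewrite inE => /andP[_ xD] /setP/(_ x).
  by rewrite !inE eqxx (negbTE xD).
have nx1 Z : Z \in shattered F1 -> x \notin Z.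
  move=> /shatteredP /(_ set0 (sub0set _))[D]; rewrite inE => /andP[_ xD] /setP/(_ x).
  by rewrite !inE xD /= => ->.
have -> : #|shattered F0 :&: shattered F1| = #|Q|.
  rewrite card_in_imset// => Z W /setIP[Z0 _] /setIP[W0 _] ZW.
  by rewrite -(setU1K (nx0 _ Z0)) ZW setU1K// nx0.
have disQ : (shattered F0 :|: shattered F1) :&: Q = set0.
  apply/setP => Z; rewrite in_set0; apply/negbTE/negP.
  by move=> /setIP[/setUP[/nx0|/nx1] xZ /imsetP[W _ ZE]]; rewrite ZE setU11 in xZ.
rewrite -[X in (X <= _)%N]subn0 -(cards0 {set J}) -disQ -cardsU subset_leq_card//.
apply/subsetP => Z; rewrite !in_setU => /orP[/orP[]|].
- by apply/subsetP/shattered_mono/subsetP => D; rewrite inE => /andP[].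
- by apply/subsetP/shattered_mono/subsetP => D; rewrite inE => /andP[].
move=> /imsetP[W /setIP[W0 W1] ->]; apply/shatteredP => Y YW.
(* A trace containing [x] is realised in [F1] and one avoiding [x] in [F0]; both halves shatter [W],
   which handles the rest of [Y]. *)
have sub : Y :\ x \subset W.
  by apply/subsetP => y; rewrite !inE => /andP[yx /(subsetP YW)]; rewrite !inE (negbTE yx).
have [xY|xY] := boolP (x \in Y).
  move/shatteredP: W1 => /(_ _ sub)[D]; rewrite inE => /andP[DF xD] DW.
  by exists D => //; rewrite setIUr DW (setIidPr _) ?sub1set// setD1K.
move/shatteredP: W0 => /(_ _ sub)[D]; rewrite inE => /andP[DF xD] DW.
exists D => //; rewrite setIUr DW (_ : D :&: [set x] = set0) ?set0U.
  by apply/setP => y; rewrite !inE; case: eqVneq => // ->; rewrite (negbTE xY).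
by apply/setP => y; rewrite !inE; case: eqVneq => [->|]; rewrite ?(negbTE xD) ?andbF.
Qed.

(* A set [Z] is recovered from [Z :\: G] and a [D]-tuple of optional points
   listing [Z :&: G]. *)
Lemma card_small_sets (J : finType) (G : {set J}) (D : nat) :
  (#|[set Z : {set J} | #|Z :&: G| <= D]%N| <= #|J|.+1 ^ D * 2 ^ #|~: G|)%N.
Proof.
pose code (u : {ffun 'I_D -> option J} * {set J}) : {set J} :=
  [set x in pmap id (codom u.1)] :|: u.2.
rewrite -card_powerset -card_option -[X in (_ ^ X)%N](card_ord D) -card_ffun.
rewrite -[X in (X * _)%N]cardsT -cardsX.
rewrite (leq_trans _ (leq_imset_card code _))// subset_leq_card//.
apply/subsetP => Z; rewrite inE => ZD; apply/imsetP.
exists ([ffun i : 'I_D => nth None (map Some (enum (Z :&: G))) i], Z :\: G).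
  by rewrite !inE/= setDE subsetIr.
rewrite -[LHS](setID _ G) /code /=; congr (_ :|: _); apply/setP => x.
rewrite [in RHS]inE mem_pmap map_id.
apply/idP/codomP => [xZ|[i]].
  have xE : x \in enum (Z :&: G) by rewrite mem_enum.
  have iD : (index x (enum (Z :&: G)) < D)%N.
    by rewrite (leq_trans _ ZD)// cardE index_mem.
  exists (Ordinal iD); rewrite ffunE /= (nth_map x) ?index_mem//.
  by rewrite nth_index.
rewrite ffunE => h.
have [iE|iE] := ltnP i (size (enum (Z :&: G))); last by rewrite nth_default ?size_map in h.
by move: h; rewrite (nth_map x)// => -[->]; rewrite -mem_enum mem_nth.
Qed.

(* Among [d + 2] points the homogenised vectors [(v j, 1)] satisfy a linear
   relation [u]; a half-space cutting out [u <= 0] would give it a positive value. *)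
Lemma halfspaces_not_shatter (R : realFieldType) (d : nat) (J : finType)
    (F : {set {set J}}) (v : J -> 'I_d -> R) (Z : {set J}) :
  (forall A, A \in F -> exists b : 'I_d -> R, exists t : R,
     forall j, j \in Z -> (j \in A) = (\sum_(k < d) v j k * b k <= t)) ->
  Z \in shattered F -> (#|Z| <= d.+1)%N.
Proof.
move=> hF /shatteredP sZ; rewrite leqNgt; apply/negP => dZ.
pose e (i : 'I_#|Z|) : J := enum_val i.
pose M : 'M[R]_(#|Z|, d.+1) :=
  \matrix_(i, k) (if unlift ord_max k is Some k' then v (e i) k' else 1).
have [u u0 uM] : exists2 u : 'rV[R]_#|Z|, u != 0 & u *m M = 0.
  have : kermx M != 0.
    rewrite kermx_eq0; apply/negP => /eqP rM.
    by have := rank_leq_col M; rewrite rM leqNgt dZ.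
  by move=> /rowV0Pn[u /sub_kermxP uM u0]; exists u.
(* The relation may be negated, so some entry can be taken positive; this entry makes the final sum
   strictly positive. *)
wlog [i0 i0p] : u u0 uM / exists i, 0 < u 0 i.
  have [i ui] := rV0Pn _ u0.
  move=> W; have [ip|ip|ip] := ltrgtP (u 0 i) 0.
  - apply: (W (- u)); rewrite ?oppr_eq0 ?mulNmx ?uM ?oppr0//.
    by exists i; rewrite mxE oppr_gt0.
  - by apply: (W u) => //; exists i.
  - by rewrite ip eqxx in ui.
have [A AF AZ] := sZ [set e i | i in [set i | u 0 i <= 0]] ltac:(by
  apply/subsetP => _ /imsetP[i _ ->]; exact: enum_valP).
have [b [t bt]] := hF A AF.
pose h i := \sum_(k < d) v (e i) k * b k - t.
(* The entries of [u] and of [h] have matching signs, so every product [u 0 i * h i] is nonnegative,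
   whereas the relation makes their sum zero. *)
have hu i : (u 0 i <= 0) = (h i <= 0).
  rewrite subr_le0 -bt ?enum_valP//; move/setP/(_ (e i)): AZ.
  rewrite inE enum_valP andbT => ->; rewrite mem_imset ?inE//.
  exact: enum_val_inj.
have : \sum_i u 0 i * h i = 0.
  have E k : \sum_i u 0 i * M i k = 0.
    by move/matrixP/(_ 0 k): uM; rewrite !mxE.
  under eq_bigr do rewrite mulrBr mulr_sumr.
  rewrite sumrB exchange_big /= -mulr_suml.
  have -> : \sum_i u 0 i = 0.
    by apply: etrans (E ord_max); apply: eq_bigr => i _; rewrite mxE unlift_none mulr1.
  rewrite mul0r subr0 big1// => k _.
  under eq_bigr do rewrite mulrA; rewrite -mulr_suml.
  rewrite (_ : \sum_i _ = 0) ?mul0r//; apply: etrans (E (lift ord_max k)).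
  by apply: eq_bigr => i _; rewrite mxE liftK.
apply/eqP; rewrite gt_eqF// (bigD1 i0)//= ltr_wpDr//.
  apply: sumr_ge0 => i _; have := hu i; have [ui hi|ui /esym/negbT] := leP (u 0 i) 0.
    by rewrite mulr_le0// -hi.
  by rewrite -ltNge => hi; rewrite mulr_ge0// ltW.
rewrite mulr_gt0//; have := hu i0; rewrite [LHS]leNgt i0p /= => /esym/negbT.
by rewrite -ltNge.
Qed.

(** Members of [F] need to look like half-spaces on [G] only. By the dimension count a shattered set
    meets [G] in at most [d.+1] points, while it is arbitrary outside [G], at the price of a factor
    2 per point. *)
Lemma card_halfspace_traces (R : realFieldType) (d : nat) (J : finType)
    (F : {set {set J}}) (v : J -> 'I_d -> R) (G : {set J}) :
  (forall A, A \in F -> exists b : 'I_d -> R, exists t : R,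
     forall j, j \in G -> (j \in A) = (\sum_(k < d) v j k * b k <= t)) ->
  (#|F| <= #|J|.+1 ^ d.+1 * 2 ^ #|~: G|)%N.
Proof.
move=> hF; apply: leq_trans (pajor _ F) (leq_trans _ (card_small_sets _ G d.+1)).
apply/subset_leq_card/subsetP => Z sZ; rewrite inE.
apply: (@halfspaces_not_shatter R d J F v); last exact: shatteredS _ _ _ _ (subsetIl _ _) sZ.
move=> A /hF[b [t bt]]; exists b, t => j /setIP[_]; exact: bt.
Qed.

(** * Relative deviations on a finite alphabet *)

(* Imported only here: classical_sets shadows the [finset] lemmas used above. *)
From mathcomp Require Import all_classical all_reals all_analysis.
From mathcomp Require Import measurable_realfun ring lra.

Import Order.TTheory GRing.Theory Num.Theory.
Import numFieldNormedType.Exports.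
Local Open Scope classical_set_scope.
Local Open Scope ring_scope.

(** The constant in this bound on [2 cosh x] is not sharp, which permits an elementary proof. For
    [x >= 1/2] one has [x <= 2 x^2]; for smaller [x >= 0], [exp u <= 1 / (1 - u)] at [u = x] and
    [u = - x] gives the sum [2 / (1 - x^2)]. *)
Lemma expR_sym_le (R : realType) (x : R) :
  expR x + expR (- x) <= 2 * expR (2 * x ^+ 2).
Proof.
wlog x0 : x / 0 <= x.
  move=> W; have [/W//|/ltW x0] := leP 0 x.
  by have := W (- x); rewrite opprK sqrrN oppr_ge0 x0 addrC; exact.
have [x2|x2] := leP 2^-1 x.
  have h1 : expR x <= expR (2 * x ^+ 2) by rewrite ler_expR; nra.
  have h2 : expR (- x) <= expR (2 * x ^+ 2) by rewrite ler_expR; nra.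
  lra.
have h u : u < 1 -> expR u <= (1 - u)^-1 :> R.
  move=> u1; rewrite -[u]opprK expRN opprK lef_pV2 ?posrE ?expR_gt0 ?subr_gt0//.
  exact: expR_ge1Dx.
have h1 := h x ltac:(lra); have h2 := h (- x) ltac:(lra).
have h3 := expR_ge1Dx (2 * x ^+ 2).
have E : (1 - x)^-1 + (1 - - x)^-1 = 2 / (1 - x ^+ 2).
  by field; apply/and3P; split; rewrite gt_eqF//; nra.
have u0 := sqr_ge0 x; have u1 : x ^+ 2 <= 2^-1 by nra.
have h4 : 2 / (1 - x ^+ 2) <= 2 * (1 + 2 * x ^+ 2).
  rewrite ler_pdivrMr ?subr_gt0; last lra.
  by have := mulr_ge0 u0 (_ : 0 <= 1 - 2 * x ^+ 2); nra.
lra.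
Qed.

(* Chernoff's bound at [u = sqrt (K m) / (4 m)]. *)
Lemma rademacher_tail (R : realType) (n : nat) (del : 'I_n -> R) (m K : R) :
  \sum_i del i ^+ 2 <= m -> 0 < K ->
  \sum_(s : {ffun 'I_n -> bool})
    (K * m < (\sum_i (-1) ^+ (s i) * del i) ^+ 2)%R%:R
  <= 2 * 2 ^+ n * expR (- (K / 8)).
Proof.
move=> dm K0.
have m0 : 0 <= m by apply: le_trans dm; apply: sumr_ge0 => i _; exact: sqr_ge0.
(* When [m = 0] all [del i] vanish and the strict inequality never holds; this case is separate
   because [u] divides by [m]. *)
move: m0; rewrite le_eqVlt => /orP[/eqP m0|m0].
  rewrite big1 ?mulr_ge0 ?expR_ge0 ?exprn_ge0// => s _.
  have d0 i : del i = 0.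
    apply/eqP; rewrite -sqrf_eq0; move: dm; rewrite -m0 => dm.
    have := @psumr_eq0P R 'I_n xpredT (fun i => del i ^+ 2) (fun i _ => sqr_ge0 _).
    by move=> -> //; apply/eqP; rewrite eq_le dm sumr_ge0// => j _; exact: sqr_ge0.
  under eq_bigr do rewrite d0 mulr0.
  by rewrite big1// expr0n/= -m0 mulr0 ltxx.
pose T (s : {ffun 'I_n -> bool}) := \sum_i (-1) ^+ (s i) * del i.
pose tau := Num.sqrt (K * m); pose u := tau / (4 * m).
have Km : 0 < K * m by rewrite mulr_gt0.
have tau0 : 0 < tau by rewrite sqrtr_gt0.
have tau2 : tau ^+ 2 = K * m by rewrite sqr_sqrtr// ltW.
have u0 : 0 < u by rewrite divr_gt0// mulr_gt0.
(* The signs are independent, so the moment generating function factors over the coordinates. *)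
have mgf v : \sum_s expR (v * T s) <= 2 ^+ n * expR (2 * v ^+ 2 * m).
  have -> : \sum_s expR (v * T s) =
      \prod_(i < n) \sum_(b : bool) expR (v * ((-1) ^+ b * del i)).
    rewrite bigA_distr_bigA/=; apply: eq_bigr => s _.
    by rewrite /T mulr_sumr expR_sum.
  have -> : (2 : R) ^+ n = \prod_(i < n) 2 by rewrite prodr_const card_ord.
  apply: (@le_trans _ _ (\prod_(i < n) (2 * expR (2 * (v * del i) ^+ 2)))).
    apply: ler_prod => i _; rewrite sumr_ge0/=; last by move=> *; exact: expR_ge0.
    rewrite big_bool/= expr1 expr0 mul1r mulN1r mulrN addrC.
    exact: expR_sym_le.
  rewrite big_split/= ler_wpM2l ?prodr_ge0// -expR_sum ler_expR.
  under eq_bigr do rewrite exprMn mulrA.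
  by rewrite -mulr_sumr ler_wpM2l// mulr_ge0// sqr_ge0.
apply: (@le_trans _ _ (\sum_s (expR (u * T s) * expR (- (u * tau)) +
                              expR (- u * T s) * expR (- (u * tau))))).
  apply: ler_sum => s _; have [h|_] := ltP; last by rewrite addr_ge0// mulr_ge0// expR_ge0.
  rewrite -!expRD.
  have : tau < `|T s|.
    by rewrite -ltr_sqr ?nnegrE ?normr_ge0 ?(ltW tau0)// tau2 real_normK// num_real.
  rewrite lter_normr => /orP[h1|h1].
    rewrite -[leLHS]addr0 lerD ?expR_ge0// -expR0 ler_expR -mulrBr.
    by rewrite mulr_ge0 ?(ltW u0)// subr_ge0 ltW.
  rewrite -[leLHS]add0r lerD ?expR_ge0// -expR0 ler_expR mulNr -mulrN -mulrBr.
  by rewrite mulr_ge0 ?(ltW u0)// subr_ge0 ltW.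
rewrite big_split/= -!mulr_suml -mulrDl.
have := mgf u; have := mgf (- u); rewrite sqrrN => h1 h2.
(* With this [u], [2 u^2 m = K/8] and [u tau = K/4]. *)
have E : - (K / 8) = 2 * u ^+ 2 * m + - (u * tau).
  have -> : K = tau ^+ 2 / m by rewrite tau2 mulfK// gt_eqF.
  by rewrite /u; field; rewrite gt_eqF.
by rewrite E expRD mulrA ler_wpM2r ?expR_ge0//; lra.
Qed.

Section FiniteProduct.
Context {R : realType} {S : finType} {n : nat}.
Variable q : S -> R.
Hypothesis q0 : forall s, 0 <= q s.
Hypothesis q1 : \sum_s q s = 1.

Lemma sum_ffun_weight : \sum_(y : {ffun 'I_n -> S}) \prod_i q (y i) = 1.
Proof.
by rewrite -(bigA_distr_bigA (fun=> q)) /= big1.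
Qed.

(** Variance of a sum of independent centred variables: only the diagonal terms of the expanded
    square survive. *)
Lemma sum_ffun_var (h : S -> R) : \sum_s q s * h s = 0 ->
  \sum_(y : {ffun 'I_n -> S}) (\prod_i q (y i)) * (\sum_i h (y i)) ^+ 2 =
  n%:R * \sum_s q s * h s ^+ 2.
Proof.
move=> h0.
have E (i j : 'I_n) : \sum_(y : {ffun 'I_n -> S}) (\prod_i q (y i)) * (h (y i) * h (y j))
    = if i == j then \sum_s q s * h s ^+ 2 else 0.
  (* Inserting factors 1 at the other coordinates turns [h (y i) * h (y j)] into a product over all
     [k], so that sum and product can be exchanged. *)
  pose phi k s := q s * ((if k == i then h s else 1) * (if k == j then h s else 1)).
  transitivity (\prod_(k < n) \sum_s phi k s).
    rewrite bigA_distr_bigA/=; apply: eq_bigr => y _.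
    by rewrite /phi !big_split/= -!big_mkcond !big_pred1_eq.
  rewrite (bigD1 i)//= {1}/phi eqxx; case: eqVneq => [ij|_].
    rewrite [X in _ * X]big1 ?mulr1; first by apply: eq_bigr => s _; rewrite expr2.
    by move=> k /negbTE ki; rewrite /phi -ij ki; under eq_bigr do rewrite !mulr1.
  by under eq_bigr do rewrite mulr1; rewrite h0 mul0r.
transitivity (\sum_(y : {ffun 'I_n -> S}) \sum_i \sum_j
    (\prod_i q (y i)) * (h (y i) * h (y j))).
  apply: eq_bigr => y _; rewrite expr2 big_distrlr/= mulr_sumr.
  by apply: eq_bigr => i _; rewrite mulr_sumr.
transitivity (\sum_(i < n) \sum_s q s * h s ^+ 2); last first.
  by rewrite sumr_const card_ord mulr_natl.
rewrite exchange_big/=; apply: eq_bigr => i _.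
rewrite exchange_big/=; under eq_bigr do rewrite E.
by rewrite -big_mkcond (big_pred1 i)// => j; rewrite eq_sym.
Qed.

(** Chebyshev's inequality for the ghost sample. The variance is at most [M / n], so the exceptional
    probability is at most [4 / (n eps^2)], which is at most 1/2 when [n eps^2 >= 8]. *)
Lemma chebyshev_half (f : S -> bool) (M eps : R) :
  (0 < n)%N -> \sum_s q s * (f s)%:R <= M -> 0 < M -> 0 < eps -> 8 <= n%:R * eps ^+ 2 ->
  2^-1 <= \sum_(y : {ffun 'I_n -> S}) (\prod_i q (y i)) *
    (((\sum_i (f (y i))%:R) / n%:R - \sum_s q s * (f s)%:R) ^+ 2
       <= eps ^+ 2 / 4 * M)%R%:R.
Proof.
move=> n0 muM M0 e0 ne.
set mu := \sum_s _ in muM *; pose nu (y : {ffun 'I_n -> S}) : R := (\sum_i (f (y i))%:R) / n%:R.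
have nR : 0 < n%:R :> R by rewrite ltr0n.
pose w (y : {ffun 'I_n -> S}) := \prod_i q (y i).
have w0 y : 0 <= w y by apply: prodr_ge0.
have V : \sum_y w y * (nu y - mu) ^+ 2 <= M / n%:R.
  have h0 : \sum_s q s * ((f s)%:R - mu) = 0.
    by under eq_bigr do rewrite mulrBr; rewrite sumrB -mulr_suml q1 mul1r subrr.
  have := sum_ffun_var _ h0.
  have -> : \sum_s q s * ((f s)%:R - mu) ^+ 2 = mu - mu ^+ 2.
    transitivity (\sum_s (q s * (f s)%:R - 2 * mu * (q s * (f s)%:R) + q s * mu ^+ 2)).
      by apply: eq_bigr => s _; case: (f s) => /=; ring.
    by rewrite big_split/= -mulr_suml q1 sumrB -mulr_sumr -/mu; ring.
  move=> Vn; apply: (@le_trans _ _ ((mu - mu ^+ 2) / n%:R)); last first.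
    by rewrite ler_pM2r ?invr_gt0//; nra.
  rewrite [leRHS](_ : _ = n%:R ^- 2 * (n%:R * (mu - mu ^+ 2))); last first.
    by field; rewrite gt_eqF.
  rewrite -Vn mulr_sumr ler_sum// => y _; rewrite [leRHS]mulrCA ler_wpM2l// -exprVn -exprMn.
  have -> : \sum_i ((f (y i))%:R - mu) = n%:R * (nu y - mu).
    rewrite sumrB sumr_const card_ord mulrBr -[mu *+ n]mulr_natl; congr (_ - _).
    by rewrite /nu mulrCA mulfV ?mulr1// gt_eqF.
  by rewrite mulKf ?gt_eqF.
have D : \sum_y w y * (eps ^+ 2 / 4 * M < (nu y - mu) ^+ 2)%R%:R <= 2^-1.
  have eM : 0 < eps ^+ 2 / 4 * M by rewrite !mulr_gt0 ?exprn_gt0.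
  apply: (@le_trans _ _ ((eps ^+ 2 / 4 * M)^-1 * \sum_y w y * (nu y - mu) ^+ 2)).
    rewrite mulr_sumr ler_sum// => y _; rewrite [leRHS]mulrCA ler_wpM2l//.
    have [/ltW h|_] := ltP; last by rewrite mulr_ge0 ?sqr_ge0// invr_ge0 ltW.
    by rewrite mulrC ler_pdivlMr// mul1r.
  apply: (@le_trans _ _ ((eps ^+ 2 / 4 * M)^-1 * (M / n%:R))).
    by rewrite ler_pM2l// invr_gt0.
  rewrite [leLHS](_ : _ = 4 / (n%:R * eps ^+ 2)); last by field; rewrite !gt_eqF.
  by rewrite ler_pdivrMr; lra.
have : \sum_y w y * ((nu y - mu) ^+ 2 <= eps ^+ 2 / 4 * M)%R%:R +
  \sum_y w y * (eps ^+ 2 / 4 * M < (nu y - mu) ^+ 2)%R%:R = 1.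
  rewrite -big_split/=; apply: etrans sum_ffun_weight; apply: eq_bigr => y _.
  by rewrite -mulrDr -[RHS]mulr1 /w; case: leP => _; rewrite /= ?addr0 ?add0r.
by rewrite -/w -/mu; lra.
Qed.

(** * Ghost sample and random swaps *)

Definition swap_ffun {A : Type} (s : {ffun 'I_n -> bool}) (z : {ffun 'I_n -> A * A}) :
    {ffun 'I_n -> A * A} :=
  [ffun i => if s i then ((z i).2, (z i).1) else z i].

Lemma swap_ffunK (A : Type) s : involutive (@swap_ffun A s).
Proof.
by move=> z; apply/ffunP => i; rewrite !ffunE; case: (s i) => //; case: (z i).
Qed.

Definition pair_weight (z : {ffun 'I_n -> S * S}) : R := \prod_i (q (z i).1 * q (z i).2).

Lemma pair_weight_swap s z : pair_weight (swap_ffun s z) = pair_weight z.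
Proof. by apply: eq_bigr => i _; rewrite ffunE; case: (s i) => //=; rewrite mulrC. Qed.

Lemma pair_weight_ge0 z : 0 <= pair_weight z.
Proof. by apply: prodr_ge0 => i _; rewrite mulr_ge0. Qed.

Lemma sum_pair_ffun (g : {ffun 'I_n -> S} -> {ffun 'I_n -> S} -> R) :
  \sum_y \sum_y' g y y' =
  \sum_(z : {ffun 'I_n -> S * S}) g [ffun i => (z i).1] [ffun i => (z i).2].
Proof.
rewrite pair_big/= (reindex (fun z : {ffun 'I_n -> S * S} =>
  ([ffun i => (z i).1], [ffun i => (z i).2])))//=.
exists (fun y : {ffun 'I_n -> S} * {ffun 'I_n -> S} => [ffun i => (y.1 i, y.2 i)])
  => [z _|[y y'] _] /=.
  by apply/ffunP => i; rewrite !ffunE; case: (z i).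
by congr pair; apply/ffunP => i; rewrite !ffunE.
Qed.

Definition pair_pattern (f : S -> bool) (z : {ffun 'I_n -> S * S}) :
    {ffun 'I_n -> bool * bool} :=
  [ffun i => (f (z i).1, f (z i).2)].

(** Relative deviation between the two halves of the double sample, written with counts instead of
    frequencies; the left side of the inequality is invariant under swaps. *)
Definition pair_dev (K : R) (p : {ffun 'I_n -> bool * bool}) : bool :=
  K * (\sum_i ((p i).1%:R + (p i).2%:R)) < (\sum_i ((p i).1%:R - (p i).2%:R)) ^+ 2.

Lemma pair_pattern_swap f s z :
  pair_pattern f (swap_ffun s z) = swap_ffun s (pair_pattern f z).
Proof. by apply/ffunP => i; rewrite !ffunE; case: (s i). Qed.

(** A swap flips the sign of one difference. The differences lie in {-1, 0, 1}, so their squares sum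
    to at most the total count, and the Rademacher tail applies with [m] equal to that count. *)
Lemma pair_dev_swap_tail (K : R) p : 0 < K ->
  \sum_s (pair_dev K (swap_ffun s p))%:R <= 2 * 2 ^+ n * expR (- (K / 8)).
Proof.
move=> K0.
have V : \sum_i ((p i).1%:R - (p i).2%:R) ^+ 2 <= \sum_i ((p i).1%:R + (p i).2%:R) :> R.
  by apply: ler_sum => i _; case: (p i) => [[] []] /=; lra.
apply: le_trans (rademacher_tail _ _ _ _ _ V K0).
rewrite le_eqVlt; apply/orP; left; apply/eqP; apply: eq_bigr => s _.
rewrite /pair_dev; congr ((_ * _ < _ ^+ _)%R%:R); apply: eq_bigr => i _; rewrite ffunE.
  by case: (s i) => //=; rewrite addrC.
by case: (s i); rewrite /= ?expr1 ?mulN1r ?opprB ?expr0 ?mul1r.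
Qed.

(* Swaps preserve the law of the double sample, so one may average over them
   first; for a fixed sample only the distinct patterns enter the union bound. *)
Lemma ghost_swap_bound (I : finType) (f : I -> S -> bool) (bad : S -> bool) (B : nat) (K : R) :
  0 < K ->
  (forall z : {ffun 'I_n -> S * S}, (forall i, 0 < q (z i).1 /\ 0 < q (z i).2) ->
    (#|[set pair_pattern (f k) z | k : I]%SET| <=
       B * 2 ^ (\sum_i (bad (z i).1 + bad (z i).2)))%N) ->
  \sum_z pair_weight z * [exists k, pair_dev K (pair_pattern (f k) z)]%:R <=
  2 * B%:R * (1 + \sum_s q s * (bad s)%:R) ^+ (2 * n) * expR (- (K / 8)).
Proof.
move=> K0 hB.
set L := \sum_z _; set E := expR _.
have Ls s : L = \sum_z pair_weight z *
    [exists k, pair_dev K (swap_ffun s (pair_pattern (f k) z))]%:R.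
  rewrite /L (reindex_inj (can_inj (swap_ffunK S s)))/=.
  apply: eq_bigr => z _; rewrite pair_weight_swap; congr (_ * _%:R).
  by congr nat_of_bool; apply: eq_existsb => k; rewrite pair_pattern_swap.
have L2 : 2 ^+ n * L = \sum_z pair_weight z *
    \sum_s [exists k, pair_dev K (swap_ffun s (pair_pattern (f k) z))]%:R.
  transitivity (\sum_(s : {ffun 'I_n -> bool}) L).
    by rewrite sumr_const card_ffun card_bool card_ord -[RHS]mulr_natl natrX.
  rewrite (eq_bigr _ (fun s _ => Ls s)) exchange_big/=.
  by apply: eq_bigr => z _; rewrite mulr_sumr.
have h : 2 ^+ n * L <= \sum_z pair_weight z *
    ((B * 2 ^ (\sum_i (bad (z i).1 + bad (z i).2)))%N%:R * (2 * 2 ^+ n * E)).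
  rewrite L2; apply: ler_sum => z _.
  (* The pattern count is assumed only for letters of positive probability; any other double sample
     has weight zero. *)
  have [/forallP zq|] := boolP [forall i, (0 < q (z i).1) && (0 < q (z i).2)]; last first.
    rewrite negb_forall => /existsP[i zi]; rewrite /pair_weight (bigD1 i)//=.
    suff -> : q (z i).1 * q (z i).2 = 0 by rewrite !mul0r.
    have qE s : ~~ (0 < q s) -> q s = 0.
      by rewrite -leNgt => qs; apply/eqP; rewrite eq_le qs q0.
    by move: zi; rewrite negb_and => /orP[] /qE ->; rewrite ?mul0r ?mulr0.
  rewrite ler_wpM2l ?pair_weight_ge0//.
  apply: (@le_trans _ _ (\sum_(p in [set pair_pattern (f k) z | k : I]%SET)
    \sum_s (pair_dev K (swap_ffun s p))%:R)).
    rewrite exchange_big/=; apply: ler_sum => s _.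
    have [/existsP[k hk]|_] :=
      boolP [exists k, pair_dev K (swap_ffun s (pair_pattern (f k) z))];
      last by rewrite sumr_ge0.
    rewrite (bigD1 (pair_pattern (f k) z))/=; last exact: imset_f.
    by rewrite hk lerDl sumr_ge0.
  apply: (@le_trans _ _ (\sum_(p in [set pair_pattern (f k) z | k : I]%SET)
    (2 * 2 ^+ n * E))).
    by apply: ler_sum => p _; exact: pair_dev_swap_tail.
  rewrite sumr_const -[leLHS]mulr_natl ler_wpM2r ?mulr_ge0 ?exprn_ge0 ?expR_ge0// ler_nat.
  by apply: hB => i; apply/andP.
(* The number of bad points is a sum over 2n independent letters, and the expectation of [2 ^ bad]
   for one letter is [1 + p]. *)
have G : \sum_z pair_weight z * 2 ^+ (\sum_i (bad (z i).1 + bad (z i).2)) =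
    (1 + \sum_s q s * (bad s)%:R) ^+ (2 * n).
  transitivity (\prod_(i < n) \sum_(a : S * S)
      (q a.1 * q a.2 * 2 ^+ (bad a.1 + bad a.2))).
    rewrite bigA_distr_bigA/=; apply: eq_bigr => z _.
    by rewrite [RHS]big_split/=; congr (_ * _); rewrite expr_sum.
  rewrite prodr_const card_ord exprM; congr (_ ^+ n).
  have -> : 1 + \sum_s q s * (bad s)%:R = \sum_s q s * 2 ^+ (bad s).
    rewrite -[X in X + _]q1 -big_split/=; apply: eq_bigr => s _.
    by case: (bad s); rewrite /= ?expr1 ?expr0; ring.
  rewrite expr2 big_distrlr/= pair_big/=; apply: eq_bigr => -[a b] _ /=.
  by rewrite exprD mulrACA.
have n2 : 0 < 2 ^+ n :> R by rewrite exprn_gt0.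
rewrite -(ler_pM2l n2); apply: (le_trans h).
rewrite -G le_eqVlt; apply/orP; left; apply/eqP.
rewrite [in RHS]mulr_sumr mulr_suml mulr_sumr; apply: eq_bigr => z _.
by rewrite natrM natrX; ring.
Qed.

(** Symmetrization: if the sample deviates for some [k], then with probability at least 1/2 the
    ghost sample stays close to the mean for this [k], and the two halves deviate from each other.
    The factor 4 is 2 from this step times 2 from the two-sided tail. *)
Lemma finite_relative_vc (I : finType) (f : I -> S -> bool) (bad : S -> bool)
    (B : nat) (eps : R) :
  (0 < n)%N -> 0 < eps -> 8 <= n%:R * eps ^+ 2 ->
  (forall z : {ffun 'I_n -> S * S}, (forall i, 0 < q (z i).1 /\ 0 < q (z i).2) ->
    (#|[set pair_pattern (f k) z | k : I]%SET| <=
       B * 2 ^ (\sum_i (bad (z i).1 + bad (z i).2)))%N) ->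
  \sum_(y : {ffun 'I_n -> S} | [exists k,
      let mu := \sum_s q s * (f k s)%:R in
      let nu := (\sum_i (f k (y i))%:R) / n%:R in
      eps ^+ 2 * Num.max mu nu < (mu - nu) ^+ 2]) \prod_i q (y i) <=
  4 * B%:R * (1 + \sum_s q s * (bad s)%:R) ^+ (2 * n) * expR (- (n%:R * eps ^+ 2 / 80)).
Proof.
move=> n0 e0 ne hB.
have nR : 0 < n%:R :> R by rewrite ltr0n.
pose mu k := \sum_s q s * (f k s)%:R.
pose nu k (y : {ffun 'I_n -> S}) : R := (\sum_i (f k (y i))%:R) / n%:R.
pose w (y : {ffun 'I_n -> S}) := \prod_i q (y i).
have w0 y : 0 <= w y by apply: prodr_ge0.
(* The 10 arises because the two frequencies add up to at most [5/2 * M], while their squared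
   difference exceeds [eps^2 M / 4]. *)
pose K := n%:R * eps ^+ 2 / 10.
have K0 : 0 < K by rewrite /K; nra.
have := @ghost_swap_bound I f bad B K K0 hB.
have -> : - (K / 8) = - (n%:R * eps ^+ 2 / 80) by rewrite /K; field.
set L := \sum_z _ => hL.
suff h : \sum_(y | [exists k, eps ^+ 2 * Num.max (mu k) (nu k y) < (mu k - nu k y) ^+ 2]) w y
    <= 2 * L by move: hL; rewrite -/w; lra.
have -> : L = \sum_y \sum_y' w y * w y' *
    [exists k, pair_dev K [ffun i => (f k (y i), f k (y' i))]]%:R.
  rewrite sum_pair_ffun; apply: eq_bigr => z _; congr (_ * _).
    rewrite /pair_weight big_split/=; congr (_ * _).
      by apply: eq_bigr => i _; rewrite ffunE.
    by apply: eq_bigr => i _; rewrite ffunE.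
  congr (nat_of_bool _)%:R; apply: eq_existsb => k; congr pair_dev.
  by apply/ffunP => i; rewrite !ffunE.
rewrite big_mkcond mulr_sumr/=; apply: ler_sum => y _.
case: ifP => [/existsP[k dev]|_]; last first.
  by rewrite mulr_ge0// sumr_ge0// => y' _; rewrite !mulr_ge0.
pose M := Num.max (mu k) (nu k y).
have mu0 : 0 <= mu k by apply: sumr_ge0 => s _; rewrite mulr_ge0.
have nu0 y' : 0 <= nu k y' by rewrite divr_ge0// ?sumr_ge0.
have muM : mu k <= M by rewrite le_max lexx.
have nuM : nu k y <= M by rewrite le_max lexx orbT.
have M0 : 0 < M.
  rewrite lt_neqAle (le_trans mu0 muM) andbT; apply/eqP => M0.
  have muE : mu k = 0 by apply/eqP; rewrite eq_le mu0 M0 muM.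
  have nuE : nu k y = 0 by apply/eqP; rewrite eq_le nu0 M0 nuM.
  by move: dev; rewrite -/M -M0 muE nuE subrr expr0n/= mulr0 ltxx.
have := @chebyshev_half (f k) M eps n0 muM M0 e0 ne; rewrite -/(mu k) => ch.
apply: (@le_trans _ _ (2 * (w y * \sum_y' w y' *
    ((nu k y' - mu k) ^+ 2 <= eps ^+ 2 / 4 * M)%R%:R))).
  by have := w0 y; nra.
rewrite ler_pM2l// mulr_sumr ler_sum// => y' _; rewrite mulrA ler_wpM2l ?mulr_ge0//.
case: (leP _ (eps ^+ 2 / 4 * M)) => /= [dev'|_]; last by rewrite ler0n.
rewrite ler_nat lt0b; apply/existsP; exists k.
rewrite /pair_dev.
under eq_bigr do rewrite ffunE/=.
under [X in _ < X ^+ 2]eq_bigr do rewrite ffunE/=.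
rewrite big_split sumrB/=.
have -> : \sum_i (f k (y i))%:R = n%:R * nu k y by rewrite mulrC divfK// gt_eqF.
have -> : \sum_i (f k (y' i))%:R = n%:R * nu k y' by rewrite mulrC divfK// gt_eqF.
suff : eps ^+ 2 / 10 * (nu k y + nu k y') < (nu k y - nu k y') ^+ 2.
  rewrite -mulrDr -mulrBr exprMn => h.
  rewrite [ltLHS](_ : _ = n%:R ^+ 2 * (eps ^+ 2 / 10 * (nu k y + nu k y'))).
    by rewrite ltr_pM2l ?exprn_gt0.
  by rewrite /K; field.
pose r := eps * Num.sqrt M.
have r0 : 0 < r by rewrite mulr_gt0// sqrtr_gt0.
have r2 : r ^+ 2 = eps ^+ 2 * M by rewrite exprMn sqr_sqrtr// ltW.
have d1 : r < `|mu k - nu k y|.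
  by rewrite -ltr_sqr ?nnegrE ?normr_ge0 ?(ltW r0)// real_normK ?num_real// r2.
have d2 : `|nu k y' - mu k| <= r / 2.
  rewrite -ler_sqr ?nnegrE ?normr_ge0 ?divr_ge0 ?(ltW r0)// real_normK ?num_real// expr_div_n r2.
  by apply: le_trans dev' _; rewrite -natrX; lra.
have d3 : r / 2 < `|nu k y - nu k y'|.
  have := ler_distD (nu k y') (mu k) (nu k y).
  by rewrite (distrC (nu k y) (nu k y')) (distrC (mu k) (nu k y')); lra.
have d4 : (r / 2) ^+ 2 < (nu k y - nu k y') ^+ 2.
  by rewrite -(real_normK (num_real (nu k y - _))) ltr_sqr ?nnegrE ?normr_ge0 ?divr_ge0 ?(ltW r0).
(* Both [mu k] and [nu k y] lie between 0 and [M], so [r < M]; thus the ghost frequency is at most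
   [M + r/2 <= 3/2 * M]. *)
have d5 : `|mu k - nu k y| <= M.
  by rewrite ler_norml; have := nu0 y; lra.
have d6 : nu k y' <= 3 / 2 * M.
  by have := ler_norm (nu k y' - mu k); lra.
move: d4; rewrite expr_div_n r2; nra.
Qed.

End FiniteProduct.

(** * Borel measurability and rational half-spaces in H *)

(** Since [|f g| <= f^2 + g^2]. Integrability is what makes the coefficients additive. *)
Lemma inL2_mul_integrable d (Omega : measurableType d) (R : realType)
    (m : {measure set Omega -> \bar R}) (f g : Omega -> R) :
  inL2 m f -> inL2 m g -> m.-integrable setT (EFin \o (fun x => f x * g x)).
Proof.
have sq h : inL2 m h -> m.-integrable setT (EFin \o (fun x => h x ^+ 2)).
  move=> [mh ih]; apply/integrableP; split.
    by apply/measurable_EFinP; exact: measurable_funX.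
  under eq_integral => x _ do rewrite /= ger0_norm ?sqr_ge0//.
  exact: ih.
move=> Lf Lg; have [mf _] := Lf; have [mg _] := Lg.
have := integrableD measurableT (sq _ Lf) (sq _ Lg).
apply: le_integrable => //.
  by apply/measurable_EFinP; exact: measurable_funM.
move=> x _ /=; rewrite lee_fin [leRHS]ger0_norm ?addr_ge0 ?sqr_ge0// normrM.
rewrite -[f x ^+ 2](real_normK (num_real _)) -[g x ^+ 2](real_normK (num_real _)).
have := normr_ge0 (f x); have := normr_ge0 (g x).
by set a := `|f x|; set b := `|g x|; have := sqr_ge0 (a - b); nra.
Qed.

Section Hilbert.
Context {d : measure_display} {Omega : measurableType d} {R : realType}.
Variables (m : {measure set Omega -> \bar R}) (psi : nat -> Omega -> R)
  (lam : nat -> R).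
Hypothesis psiL2 : forall j, inL2 m (psi j).
Hypothesis lam0 : forall j, 0 < lam j.

Local Notation H := (Htype m psi lam).
Local Notation Hb := (Hborel m psi lam).
Local Notation cf x k := (coef m psi (proj1_sig x) k).

Lemma coefB (x y : H) j :
  coef m psi (proj1_sig x \- proj1_sig y) j = cf x j - cf y j.
Proof.
have [Lx _] := proj2_sig x; have [Ly _] := proj2_sig y.
rewrite /coef /ipL2 -RintegralB//; try exact: inL2_mul_integrable.
by congr Rintegral; apply/funext => z /=; rewrite mulrBl.
Qed.

Definition sqnormH (x : H) : R := limn (series (fun k => cf x k ^+ 2 / lam k)).

Lemma sqnormH_cvg (x : H) : cvgn (series (fun k => cf x k ^+ 2 / lam k)).
Proof. by case: (proj2_sig x). Qed.

Lemma series_nneg_le_lim (u : nat -> R) n : (forall k, 0 <= u k) ->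
  cvgn (series u) -> series u n <= limn (series u).
Proof. by move=> u0 cu; apply: nondecreasing_cvgn_le => //; exact: nondecreasing_series. Qed.

Lemma sqnormH_ge (x : H) n : series (fun k => cf x k ^+ 2 / lam k) n <= sqnormH x.
Proof.
apply: series_nneg_le_lim (sqnormH_cvg x) => k.
by rewrite divr_ge0 ?sqr_ge0// ltW.
Qed.

Lemma sqnormH_ge0 (x : H) : 0 <= sqnormH x.
Proof. by have := sqnormH_ge x 0; rewrite /series/= big_geq. Qed.

Lemma mul_div_le (a b : R) k : `|(lam k)^-1 * a * b| <= a ^+ 2 / lam k + b ^+ 2 / lam k.
Proof.
rewrite -mulrA normrM ger0_norm ?invr_ge0 ?(ltW (lam0 k))// mulrC -mulrDl.
rewrite ler_wpM2r ?invr_ge0 ?(ltW (lam0 k))// ler_norml.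
by apply/andP; split; have := sqr_ge0 (a - b); have := sqr_ge0 (a + b); nra.
Qed.

Lemma ipH_cvg (x y : H) : series (fun k => (lam k)^-1 * cf x k * cf y k) @ \oo --> ipH x y.
Proof.
suff : cvgn (series (fun k => (lam k)^-1 * cf x k * cf y k)) by [].
apply: normed_cvg.
apply: (series_le_cvg (v_ := (fun k => cf x k ^+ 2 / lam k) + (fun k => cf y k ^+ 2 / lam k))).
- by move=> k /=.
- by move=> k; rewrite addr_ge0// divr_ge0 ?sqr_ge0 ?(ltW (lam0 k)).
- by move=> k; exact: mul_div_le.
- by apply: is_cvg_seriesD; exact: sqnormH_cvg.
Qed.

(** One term of the series for the squared distance is at most the whole sum. Coefficients are
    therefore continuous, hence Borel, and inner products are pointwise limits of their
    combinations. *)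
Lemma coef_lipschitz (x y : H) j : `|cf x j - cf y j| <= Num.sqrt (lam j) * distH x y.
Proof.
rewrite /distH /ipHf.
pose u k := (cf x k - cf y k) ^+ 2 / lam k.
have -> : (fun k => (lam k)^-1 * coef m psi (proj1_sig x \- proj1_sig y) k *
    coef m psi (proj1_sig x \- proj1_sig y) k) = u.
  by apply/funext => k; rewrite coefB /u; ring.
have u0 k : 0 <= u k by rewrite divr_ge0 ?sqr_ge0 ?(ltW (lam0 k)).
have cu : cvgn (series u).
  pose w := (fun k => cf x k ^+ 2 / lam k) + (fun k => cf y k ^+ 2 / lam k).
  have w0 k : 0 <= w k by rewrite addr_ge0// divr_ge0 ?sqr_ge0 ?(ltW (lam0 k)).
  have cw : cvgn (series w) by apply: is_cvg_seriesD; exact: sqnormH_cvg.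
  apply: (series_le_cvg (v_ := w + w)); [exact: u0| | |exact: is_cvg_seriesD].
    by move=> k; rewrite addr_ge0.
  move=> k; rewrite /u -[(w + w) k]/(cf x k ^+ 2 / lam k + cf y k ^+ 2 / lam k +
    (cf x k ^+ 2 / lam k + cf y k ^+ 2 / lam k)) -!mulrDl.
  rewrite ler_wpM2r ?invr_ge0 ?(ltW (lam0 k))//.
  by have := sqr_ge0 (cf x k + cf y k); nra.
have uj : u j <= limn (series u).
  apply: le_trans (series_nneg_le_lim _ j.+1 u0 cu).
  by rewrite /series/= big_nat_recr//= lerDr sumr_ge0.
have l0 := lam0 j.
rewrite -sqrtrM ?(ltW l0)// -sqrtr_sqr ler_wsqrtr//.
by rewrite mulrC -ler_pdivrMr.
Qed.

Lemma measurable_coef j : measurable_fun setT (fun x : Hb => cf x j).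
Proof.
apply: (measurability _ (RGenOInfty.measurableE R)) => _ [_ [a ->] <-].
rewrite setTI; apply: sub_sigma_algebra => /= x; rewrite /= in_itv/= andbT => ax.
have s0 : 0 < Num.sqrt (lam j) by rewrite sqrtr_gt0.
exists ((cf x j - a) / Num.sqrt (lam j)); first by rewrite divr_gt0// subr_gt0.
move=> y; rewrite ltr_pdivlMr// mulrC => h; rewrite /= in_itv/= andbT.
have := le_lt_trans (coef_lipschitz x y j) h.
by have := ler_norm (cf x j - cf y j); lra.
Qed.

Lemma measurable_ipH (theta : H) : measurable_fun setT (fun x : Hb => ipH x theta).
Proof.
apply: (measurable_fun_cvg (h :=
  fun n (x : Hb) => series (fun k => (lam k)^-1 * cf x k * cf theta k) n)).
  move=> n; rewrite /series/=; apply: measurable_sum => k.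
  by do 2! apply: measurable_funM => //; exact: measurable_coef.
by move=> x _; exact: ipH_cvg.
Qed.

Lemma measurable_halfspace (theta : H) (t : R) :
  measurable ([set x | ipH x theta <= t] : set Hb).
Proof.
rewrite -[X in measurable X]setTI.
have := measurable_ipH theta measurableT `]-oo, t]%classic (measurable_itv _).
by congr (measurable (_ `&` _)); apply/seteqP; split => x /=; rewrite in_itv.
Qed.

Lemma measurable_coef0 (dd : nat) :
  measurable ([set x | forall k, (dd <= k)%N -> cf x k = 0] : set Hb).
Proof.
rewrite [X in measurable X](_ : _ =
    \bigcap_(k in [set k | (dd <= k)%N]) ((fun x : Hb => cf x k) @^-1` [set 0])).
  apply: bigcap_measurable => [|k _]; first by exists dd => /=.
  by rewrite -[X in measurable X]setTI; exact: measurable_coef.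
by apply/seteqP; split => x /= h k; exact: h.
Qed.

Lemma tail_posE (dd : nat) :
  @tail_pos _ _ _ m psi lam dd = ~` [set x | forall k, (dd <= k)%N -> cf x k = 0].
Proof.
pose u (x : H) k := (lam (k + dd)%N)^-1 * cf x (k + dd)%N ^+ 2.
apply/seteqP; split => x; rewrite /tail_pos /= -/(u x).
  move=> h x0; move: h; rewrite (_ : series _ = fun _ => 0) ?lim_cst ?ltxx//.
  apply/funext => n; rewrite /series/= big1// => k _.
  by rewrite /u x0 ?leq_addl// expr0n mulr0.
move=> /existsNP[k /not_implyP[dk xk]].
have u0 i : 0 <= u x i by rewrite mulr_ge0 ?sqr_ge0 ?invr_ge0 ?(ltW (lam0 _)).
(* Convergence must be shown before [limn] can be compared with partial sums, since [limn] of a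
   divergent sequence is a default value. *)
have cu : cvgn (series (u x)).
  apply: nondecreasing_is_cvgn; first exact: nondecreasing_series.
  exists (sqnormH x) => _ [n _ <-].
  apply: le_trans (sqnormH_ge x (n + dd)).
  rewrite /series/= (@big_cat_nat _ _ _ dd 0 (n + dd))//= ?leq_addl//.
  apply: ler_wpDl.
    by rewrite sumr_ge0// => i _; rewrite divr_ge0 ?sqr_ge0 ?(ltW (lam0 _)).
  rewrite -{1}[dd]add0n big_addn addnK.
  by under eq_bigr do rewrite /u mulrC.
apply: lt_le_trans (series_nneg_le_lim _ (k - dd).+1 u0 cu).
rewrite /series/= big_nat_recr//= ltr_wpDl ?sumr_ge0//.
rewrite /u subnK// mulr_gt0 ?invr_gt0// lt_neqAle sqr_ge0 andbT eq_sym sqrf_eq0.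
exact/eqP.
Qed.

(** The rational weights stand for [cf theta k / lam k], so the factor [lam k] does not appear. *)
Definition ratlin (b : seq rat) (x : H) : R := \sum_(k < size b) cf x k * ratr (b`_k).

Lemma ipH_ratlin_approx (theta : H) (eta : R) : 0 < eta ->
  exists b : seq rat, forall x : H, `|ipH x theta - ratlin b x| <= eta * (sqnormH x + 1).
Proof.
move=> eta0.
have e2 : 0 < eta ^+ 2 by rewrite exprn_gt0.
have [N hN] : exists N, forall n, (N <= n)%N ->
    `|sqnormH theta - series (fun k => cf theta k ^+ 2 / lam k) n| <= eta ^+ 2.
  by have /cvgrPdist_le/(_ _ e2)[N _ hN] := sqnormH_cvg theta; exists N.
have hr0 k : exists q : rat,
    lam k * (cf theta k / lam k - ratr q) ^+ 2 <= eta ^+ 2 / N.+1%:R.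
  pose rho := Num.sqrt (eta ^+ 2 / N.+1%:R / lam k).
  have r0 : 0 < rho by rewrite sqrtr_gt0 !divr_gt0.
  have wr : cf theta k / lam k < cf theta k / lam k + rho by rewrite ltrDl.
  have [q] := rat_in_itvoo wr.
  rewrite in_itv/= => /andP[q1 q2]; exists q.
  have : (cf theta k / lam k - ratr q) ^+ 2 <= rho ^+ 2 by nra.
  rewrite sqr_sqrtr; last by rewrite !divr_ge0// ltW.
  by rewrite ler_pdivlMr// mulrC.
have [r hr] := choice hr0; exists (mkseq r N) => x.
(* Error in the weights: rounding below [N], the full weight beyond. In the norm weighted by
   [lam k], each part contributes at most [eta ^+ 2]. *)
pose e k := if (k < N)%N then cf theta k / lam k - ratr (r k) else cf theta k / lam k.
have rl n : (N <= n)%N ->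
    series (fun k => (lam k)^-1 * cf x k * cf theta k) n - ratlin (mkseq r N) x
    = \sum_(0 <= k < n) cf x k * e k.
  move=> Nn; rewrite /ratlin size_mkseq /series/=.
  rewrite -(big_mkord xpredT (fun k => cf x k * ratr (mkseq r N)`_k)).
  rewrite !(@big_cat_nat _ _ _ N 0 n)//= addrAC -sumrB; congr (_ + _).
    by apply: eq_big_nat => k /andP[_ kN]; rewrite /e kN nth_mkseq//; ring.
  by apply: eq_big_nat => k /andP[kN _]; rewrite /e ltnNge kN/=; ring.
have se n : (N <= n)%N -> \sum_(0 <= k < n) lam k * e k ^+ 2 <= 2 * eta ^+ 2.
  move=> Nn; rewrite (@big_cat_nat _ _ _ N 0 n)//= mulr2n mulrDl mul1r lerD//.
    apply: (@le_trans _ _ (\sum_(0 <= k < N) eta ^+ 2 / N.+1%:R)).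
      rewrite big_nat [leRHS]big_nat ler_sum// => k /andP[_ kN].
      by rewrite /e kN.
    rewrite sumr_const_nat subn0 -[leLHS]mulr_natl mulrCA ler_piMr ?(ltW e2)//.
    by rewrite ler_pdivrMr// mul1r ler_nat.
  have h1 := hN N (leqnn N); have h2 := sqnormH_ge theta n.
  move: h1 h2; rewrite /series/= (@big_cat_nat _ _ _ N 0 n)//=.
  rewrite ler_norml => /andP[_ h1 h2].
  rewrite [leLHS](_ : _ = \sum_(N <= k < n) cf theta k ^+ 2 / lam k); first by lra.
  apply: eq_big_nat => k /andP[kN _]; rewrite /e ltnNge kN/=; field.
  by rewrite gt_eqF.
have bd n : (N <= n)%N ->
    `|series (fun k => (lam k)^-1 * cf x k * cf theta k) n - ratlin (mkseq r N) x|
      <= eta * (sqnormH x + 1).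
  move=> Nn; rewrite rl//; apply: le_trans (ler_norm_sum _ _ _) _.
  (* Young's inequality with parameter [eta]; the two sums are at most [eta/2 * sqnormH x] and
     [eta]. *)
  apply: (@le_trans _ _ (\sum_(0 <= k < n)
      (eta / 2 * (cf x k ^+ 2 / lam k) + (2 * eta)^-1 * (lam k * e k ^+ 2)))).
    apply: ler_sum => k _.
    have l0 := lam0 k; have := sqr_ge0 (eta * `|cf x k| - lam k * `|e k|).
    rewrite normrM -[cf x k ^+ 2](real_normK (num_real _)).
    rewrite -[e k ^+ 2](real_normK (num_real _)).
    move: `|cf x k| `|e k| => a b ab.
    rewrite -subr_ge0 [leRHS](_ : _ = (eta * a - lam k * b) ^+ 2 / (2 * eta * lam k)).
      by rewrite divr_ge0// !mulr_ge0// ltW.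
    by field; rewrite !gt_eqF.
  rewrite big_split/= -!mulr_sumr.
  have h1 := sqnormH_ge x n; have h2 := se n Nn.
  rewrite /series/= in h1.
  have h3 : (2 * eta)^-1 * (\sum_(0 <= k < n) lam k * e k ^+ 2) <= eta.
    rewrite mulrC ler_pdivrMr ?mulr_gt0//; apply: le_trans h2 _.
    by rewrite expr2 mulrCA.
  have := sqnormH_ge0 x; nra.
have cv : `|series (fun k => (lam k)^-1 * cf x k * cf theta k) n - ratlin (mkseq r N) x|
    @[n --> \oo] --> `|ipH x theta - ratlin (mkseq r N) x|.
  by apply: cvg_norm; apply: cvgB; [exact: ipH_cvg|exact: cvg_cst].
by apply: (cvgr_to_le cv); exists N.
Qed.

Definition rathalf (p : seq rat * rat) (x : H) : bool := ratlin p.1 x <= ratr p.2.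

(* The inner product is approximated to order [1/j^2] while the threshold exceeds
   [t] by order [1/j], so that boundary points are eventually included and points
   outside eventually excluded. *)
Lemma rathalf_approx (theta : H) (t : R) :
  exists p : nat -> seq rat * rat, forall x : H,
    \forall j \near \oo, rathalf (p j) x = (ipH x theta <= t).
Proof.
have h j : exists p : seq rat * rat,
    (forall x : H, `|ipH x theta - ratlin p.1 x| <= (j.+1%:R^-1) ^+ 2 * (sqnormH x + 1)) /\
    t + j.+1%:R^-1 < ratr p.2 < t + 2 * j.+1%:R^-1.
  have j0 : 0 < j.+1%:R^-1 :> R by rewrite invr_gt0.
  have [b hb] := ipH_ratlin_approx theta ((j.+1%:R^-1) ^+ 2) ltac:(by rewrite exprn_gt0).
  have tj : t + j.+1%:R^-1 < t + 2 * j.+1%:R^-1.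
    by rewrite ltrD2l mulr2n mulrDl mul1r ltrDr.
  have [q] := rat_in_itvoo tj.
  by rewrite in_itv/= => hq; exists (b, q).
have [p hp] := choice h; exists p => x.
pose s := sqnormH x + 1.
have s0 : 0 < s by rewrite ltr_wpDl ?sqnormH_ge0.
(* Beyond [J], [j.+1] exceeds [s], so the approximation error is at most [1/(j+1)]; off the
   boundary, [3/(j+1)] is also below the gap. On the boundary the quotient is 0 by convention. *)
pose J := Num.truncn (s + 3 / `|ipH x theta - t|).
exists J => // j /= Jj.
have [h1 /andP[h2 h3]] := hp j; have := h1 x; rewrite -/s => {}h1.
have i0 : 0 <= 3 / `|ipH x theta - t| by rewrite divr_ge0.
have jJ : s + 3 / `|ipH x theta - t| < j.+1%:R.
  rewrite -truncn_lt_nat ?ltnS//; lra.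
have j0 : 0 < j.+1%:R :> R by rewrite ltr0n.
have v0 : 0 < j.+1%:R^-1 :> R by rewrite invr_gt0.
have vs : (j.+1%:R^-1) ^+ 2 * s <= j.+1%:R^-1.
  rewrite expr2 -mulrA ler_piMr ?(ltW v0)// mulrC ler_pdivrMr// mul1r; lra.
move: h1; rewrite ler_norml => /andP[h1 h1'].
have dt : ipH x theta != t -> 3 * j.+1%:R^-1 < `|ipH x theta - t|.
  rewrite -subr_eq0 -normr_gt0 => dt; rewrite ltr_pdivrMr// mulrC -ltr_pdivrMr//.
  by lra.
move: h1 h1' h2 h3 vs v0 dt; move: (j.+1%:R^-1) => v h1 h1' h2 h3 vs v0 dt.
rewrite /rathalf; have [it|it] := leP (ipH x theta) t.
  by apply/idP; lra.
apply/negbTE; rewrite -ltNge.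
have := dt; rewrite gt_eqF// gtr0_norm ?subr_gt0// => /(_ isT) {}dt.
by lra.
Qed.

Lemma measurable_rathalf p : measurable ([set x | rathalf p x] : set Hb).
Proof.
have mf : measurable_fun setT (fun x : Hb => ratlin p.1 x).
  apply: measurable_sum => k; apply: measurable_funM => //; exact: measurable_coef.
rewrite -[X in measurable X]setTI.
have := mf measurableT `]-oo, ratr p.2]%classic (measurable_itv _).
by congr (measurable (_ `&` _)); apply/seteqP; split => x /=; rewrite in_itv.
Qed.

End Hilbert.

(** * Deviation bound for a fixed truncation level *)

Lemma probability_fin_partition d (T : measurableType d) (R : realType)
    (P : probability T R) (S : finType) (code : T -> S) (B : pred S) :
  (forall s, measurable [set x | code x = s]) ->
  fine (P [set x | B (code x)]) = \sum_(s | B s) fine (P [set x | code x = s]).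
Proof.
move=> mc.
have -> : [set x | B (code x)] = \bigcup_(s in [set` enum B]) [set x | code x = s].
  apply/seteqP; split => x /=; first by exists (code x) => //=; rewrite mem_enum.
  by move=> [s /=]; rewrite mem_enum => Bs ->.
rewrite measure_fin_bigcup//; last first.
  by move=> i j _ _ [x [/= <- <-]].
rewrite -fsbig_seq ?enum_uniq// big_enum/=.
under eq_bigr => s _ do rewrite -[P _]fineK ?fin_num_measure//.
by rewrite sumEFin.
Qed.

Lemma iid_law_code d (Omega : measurableType d) (R : realType)
    (m : {measure set Omega -> \bar R}) psi lam
    (mu : probability (Hborel m psi lam) R) d' (T : measurableType d')
    (P : probability T R) n (X : 'I_n -> T -> Hborel m psi lam)
    (S : finType) (code : Hborel m psi lam -> S) :
  iid_law P mu X -> (forall s, measurable [set x | code x = s]) ->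
  forall y : {ffun 'I_n -> S},
    measurable [set w | [ffun i => code (X i w)] = y] /\
    fine (P [set w | [ffun i => code (X i w)] = y]) =
    \prod_i fine (mu [set x | code x = y i]).
Proof.
move=> [mX iidX] mc y.
have -> : [set w | [ffun i => code (X i w)] = y] =
    \bigcap_(i in [set: 'I_n]) (X i @^-1` [set x | code x = y i]).
  apply/seteqP; split => w /=; first by move=> <- i _ /=; rewrite ffunE.
  by move=> h; apply/ffunP => i; rewrite ffunE; exact: h.
split; last exact: iidX.
apply: fin_bigcap_measurable => [|i _]; first exact: finite_finset.
by rewrite -[X in measurable X]setTI; exact: mX.
Qed.

Lemma cvg_probability d (T : measurableType d) (R : realType) (P : probability T R)
    (A : nat -> set T) (B : set T) :
  (forall j, measurable (A j)) -> measurable B ->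
  (forall x, \forall j \near \oo, (x \in A j) = (x \in B)) ->
  fine (P (A j)) @[j --> \oo] --> fine (P B).
Proof.
move=> mA mB AB.
have E C : measurable C -> P C = (\int[P]_(x in setT) (\1_C x)%:E)%E.
  by move=> mC; rewrite integral_indic// setIT.
apply: fine_cvg; rewrite fineK ?fin_num_measure// E//.
under eq_cvg => j do rewrite E//.
apply: (@dominated_cvg _ _ _ _ _ _ _ _ (cst 1%E)) => //.
- by move=> j; apply/measurable_EFinP; exact: measurable_indic.
- move=> x _; apply: cvg_near_cst.
  by apply: filterS (AB x) => j; rewrite !indicE => ->.
- exact: finite_measure_integrable_cst.
- by move=> j x _; rewrite /= lee_fin indicE; case: (x \in A j); rewrite ?normr1 ?normr0.
Qed.

Lemma big_ord_trunc (R : nmodType) (N M : nat) (F : nat -> R) :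
  (forall k, (N <= k)%N -> (k < M)%N -> F k = 0) ->
  (forall k, (M <= k)%N -> (k < N)%N -> F k = 0) ->
  \sum_(k < N) F k = \sum_(k < M) F k.
Proof.
wlog NM : N M / (N <= M)%N.
  move=> W h1 h2; have [/W|/ltnW/W] := leqP N M; first exact.
  by move=> h; rewrite h.
move=> h _; rewrite -!(big_mkord xpredT F) [RHS](@big_cat_nat _ _ _ N)//=.
rewrite [X in _ + X]big_nat_cond [X in _ + X]big1 ?addr0//.
by move=> k /andP[/andP[k1 k2] _]; exact: h.
Qed.

Section UniformDeviation.
Context {d : measure_display} {Omega : measurableType d} {R : realType}.
Variables (m : {measure set Omega -> \bar R}) (psi : nat -> Omega -> R)
  (lam : nat -> R).
Hypothesis psiL2 : forall j, inL2 m (psi j).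
Hypothesis lam0 : forall j, 0 < lam j.
Local Notation H := (Htype m psi lam).
Local Notation Hb := (Hborel m psi lam).
Local Notation cf x k := (coef m psi (proj1_sig x) k).
Variable mu : probability (Hborel m psi lam) R.

Lemma ratlin_trunc (b : seq rat) (dd : nat) (x : H) :
  (forall k, (dd <= k)%N -> cf x k = 0) ->
  ratlin m psi lam b x = \sum_(k < dd) cf x k * ratr (b`_k).
Proof.
move=> x0; apply: (big_ord_trunc _ _ _ (fun k => cf x k * ratr b`_k)) => k h _.
  by rewrite nth_default// rmorph0 mulr0.
by rewrite x0// mul0r.
Qed.

(* Squaring clears the denominator of [sup_stat], whose value [0 / 0] is [0]. *)
Definition halfdev {n : nat} (eps : R) (Xs : 'I_n -> Hb) (p : seq rat * rat) : bool :=
  let F := fine (mu [set x | rathalf m psi lam p x]) in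
  let Fn := (\sum_i (rathalf m psi lam p (Xs i))%:R) / n%:R in
  eps ^+ 2 * Num.max F Fn < (F - Fn) ^+ 2.

(** The gap between [e] and [eps] yields one half-space with ratio strictly above [e], and strict
    inequalities survive the passage to a nearby rational half-space. *)
Lemma sup_stat_halfdev (n : nat) d' (T : measurableType d') (X : 'I_n -> T -> Hb)
    (w : T) (e eps : R) : 0 <= e -> e < eps ->
  eps <= sup_stat mu X w -> exists p, halfdev e (X ^~ w) p.
Proof.
move=> e0 ee es.
have [r [theta [t ->]] er] := sup_gt
  (ex_intro _ _ (ex_intro _ (H0 m psi lam) (ex_intro _ 0 erefl))) (lt_le_trans ee es).
set F := Fth mu theta t in er; set Fn := Fthn _ theta t in er.
have [p hp] := rathalf_approx m psi lam lam0 theta t.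
have Fn_eq : Fn = (\sum_i (ipH (X i w) theta <= t)%R%:R) / n%:R.
  rewrite /Fn /Fthn -sum1_card natr_sum big_mkcond/=; congr (_ / _).
  apply: eq_bigr => i _.
  rewrite (_ : (i \in _) = (ipH (X i w) theta <= t)); first by case: (_ <= t).
  by apply/idP/idP => [/set_mem|h]; last exact/mem_set.
have F0 : 0 <= F by rewrite fine_ge0.
have Fn0 : 0 <= Fn by rewrite Fn_eq divr_ge0// sumr_ge0.
(* A vanishing maximum would make the quotient 0 by convention, contradicting that it exceeds
   [e >= 0]. *)
have M0 : 0 < Num.max F Fn.
  rewrite lt_neqAle le_max F0 andbT; apply/eqP => M0.
  by move: er; rewrite -M0 sqrtr0 invr0 mulr0 ltNge e0.
have dev : e ^+ 2 * Num.max F Fn < (F - Fn) ^+ 2.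
  move: er; rewrite ltr_pdivlMr ?sqrtr_gt0// => er.
  have : (e * Num.sqrt (Num.max F Fn)) ^+ 2 < `|F - Fn| ^+ 2.
    by rewrite ltr_sqr ?nnegrE ?normr_ge0// mulr_ge0// sqrtr_ge0.
  by rewrite exprMn sqr_sqrtr ?(ltW M0)// real_normK// num_real.
pose Fj j := fine (mu [set x | rathalf m psi lam (p j) x]).
have cF : Fj j @[j --> \oo] --> F.
  apply: cvg_probability.
  - by move=> j; exact: measurable_rathalf.
  - exact: measurable_halfspace.
  - by move=> x; apply: filterS (hp x) => j hj; apply/idP/idP => /set_mem /= h;
      apply/mem_set => /=; move: h; rewrite hj.
(* Only [n] sample points are involved, so the empirical frequency is eventually equal to its
   limit. *)
have cFn : \forall j \near \oo, (\sum_i (rathalf m psi lam (p j) (X i w))%:R) / n%:R = Fn :> R.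
  have : \forall j \near \oo, forall i : 'I_n,
      rathalf m psi lam (p j) (X i w) = (ipH (X i w) theta <= t).
    by apply: filter_forall => i; exact: hp.
  apply: filterS => j hj; rewrite Fn_eq; congr (_ / _).
  by apply: eq_bigr => i _; rewrite hj.
have cd : (Fj j - Fn) ^+ 2 -
    e ^+ 2 * Fj j @[j --> \oo]
    --> (F - Fn) ^+ 2 - e ^+ 2 * F.
  rewrite !expr2; apply: cvgB; last by apply: cvgM => //; exact: cvg_cst.
  by apply: cvgM; apply: cvgB => //; exact: cvg_cst.
have cd' : (Fj j - Fn) ^+ 2 @[j --> \oo]
    --> (F - Fn) ^+ 2.
  by rewrite !expr2; apply: cvgM; apply: cvgB => //; exact: cvg_cst.
have [d1 d2] : e ^+ 2 * F < (F - Fn) ^+ 2 /\ e ^+ 2 * Fn < (F - Fn) ^+ 2.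
  by split; apply: le_lt_trans dev; rewrite ler_wpM2l ?sqr_ge0// le_max lexx ?orbT.
have n1 : \forall j \near \oo, 0 < (Fj j - Fn) ^+ 2 - e ^+ 2 * Fj j.
  by apply: (cvgr_gt _ cd); rewrite subr_gt0.
have n2 : \forall j \near \oo, e ^+ 2 * Fn < (Fj j - Fn) ^+ 2.
  exact: (cvgr_gt _ cd').
have [j [h1 [h2 h3]]] := filter_ex (filterI cFn (filterI n1 n2)).
exists (p j); rewrite /halfdev h1.
by rewrite subr_gt0 in h2; rewrite -/(Fj j); have [_|_] := leP (Fj j) Fn.
Qed.

Section FiniteSubclass.
Variables (pcl : nat -> seq rat * rat) (K dd : nat).

(* The boolean component records whether [x] is bad, that is, outside the span of
   the first [dd] basis functions. *)
Definition subclass_code (x : Hb) : {ffun 'I_K -> bool} * bool :=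
  ([ffun k : 'I_K => rathalf m psi lam (pcl k) x],
   `[< exists2 k, (dd <= k)%N & cf x k != 0 >]).

Lemma tail_pos_set :
  @tail_pos _ _ _ m psi lam dd = [set x | exists2 k, (dd <= k)%N & cf x k != 0].
Proof.
rewrite tail_posE//; apply/seteqP; split => x /=.
  by move=> /existsNP[k /not_implyP[dk /eqP xk]]; exists k.
by move=> [k dk /eqP xk] h; apply: xk; exact: h.
Qed.

Lemma measurable_tail_pos : measurable (@tail_pos _ _ _ m psi lam dd).
Proof. by rewrite tail_posE//; apply: measurableC; exact: measurable_coef0. Qed.

Lemma measurable_subclass_code s : measurable [set x | subclass_code x = s].
Proof.
have -> : [set x | subclass_code x = s] =
    (\bigcap_(k in [set: 'I_K]) [set x | rathalf m psi lam (pcl k) x = s.1 k]) `&`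
    (if s.2 then @tail_pos _ _ _ m psi lam dd else ~` @tail_pos _ _ _ m psi lam dd).
  rewrite tail_pos_set; apply/seteqP; split => x.
    move=> /= <-; split; first by move=> k _ /=; rewrite ffunE.
    by rewrite /subclass_code/=; case: asboolP.
  move=> [/= h1 h2]; rewrite /subclass_code; case: s h1 h2 => s b /= h1 h2; congr pair.
    by apply/ffunP => k; rewrite ffunE; exact: h1.
  by case: b h2 => h2; [apply/asboolP|apply/asboolPn].
apply: measurableI.
  apply: fin_bigcap_measurable => [|k _]; first exact: finite_finset.
  case: (s.1 k); first exact: measurable_rathalf.
  rewrite (_ : [set _ | _] = ~` [set x | rathalf m psi lam (pcl k) x]).
    by apply: measurableC; exact: measurable_rathalf.
  by apply/seteqP; split => x /= => [->|/negP/negbTE].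
by case: s.2; [|apply: measurableC]; exact: measurable_tail_pos.
Qed.

(** The double sample is viewed as 2n points indexed by ['I_n * bool]. On good points a rational
    half-space depends on [dd] coordinates only, so the trace bound applies with [G] the good
    points. *)
Lemma card_subclass_patterns (n : nat) (x : 'I_n * bool -> Hb)
    (z : {ffun 'I_n -> ({ffun 'I_K -> bool} * bool) * ({ffun 'I_K -> bool} * bool)}) :
  (forall i, subclass_code (x (i, false)) = (z i).1 /\ subclass_code (x (i, true)) = (z i).2) ->
  (#|[set pair_pattern (fun s : {ffun 'I_K -> bool} * bool => s.1 k) z | k : 'I_K]%SET| <=
    (2 * n).+1 ^ dd.+1 * 2 ^ (\sum_i ((z i).1.2 + (z i).2.2)))%N.
Proof.
move=> xz.
pose side (A : Type) (j : 'I_n * bool) (p : A * A) := if j.2 then p.2 else p.1.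
have xs j : subclass_code (x j) = side _ j (z j.1).
  by case: j => i [] /=; rewrite /side/=; case: (xz i).
pose toset (t : {ffun 'I_n -> bool * bool}) : {set 'I_n * bool} :=
  [set j | side _ j (t j.1)]%SET.
have toset_inj : injective toset.
  move=> t t' /setP h; apply/ffunP => i.
  have := h (i, false); have := h (i, true); rewrite !inE /side/=.
  by case: (t i) (t' i) => [a b] [a' b'] /= -> ->.
pose G := [set j | ~~ (side _ j (z j.1)).2]%SET.
rewrite -(card_imset _ toset_inj).
have -> : (2 * n)%N = #|{: 'I_n * bool}| by rewrite card_prod card_ord card_bool mulnC.
have -> : (\sum_i ((z i).1.2 + (z i).2.2))%N = #|~: G|.
  rewrite -sum1_card [RHS]big_mkcond/=.
  transitivity (\sum_(i < n) \sum_(b : bool) ((i, b) \in ~: G))%N; last first.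
    by rewrite pair_bigA; apply: eq_bigr => -[i b] _ /=; case: (_ \in _).
  apply: eq_bigr => i _; rewrite big_bool !inE /side/= !negbK addnC.
  by case: (z i).1.2; case: (z i).2.2.
apply: (@card_halfspace_traces R dd _ _ (fun j k => cf (x j) k)).
move=> A /imsetP[t /imsetP[k _ ->] ->].
exists (fun i : 'I_dd => ratr ((pcl k).1)`_i), (ratr (pcl k).2) => j jG.
have xj0 : forall i, (dd <= i)%N -> cf (x j) i = 0.
  move=> i di; apply/eqP; apply: contraTT jG => xi; rewrite inE negbK -xs.
  by rewrite /subclass_code/=; apply/asboolP; exists i.
rewrite -ratlin_trunc// inE ffunE.
have := xs j; rewrite /side /subclass_code => xsj.
have -> : (if j.2 then ((z j.1).1.1 k, (z j.1).2.1 k).2 else ((z j.1).1.1 k, (z j.1).2.1 k).1)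
    = (if j.2 then (z j.1).2 else (z j.1).1).1 k by case: j.2.
by rewrite -xsj/= ffunE.
Qed.

(** Both the mean and the empirical frequency of the first [K] half-spaces are functions of the
    code, whose sample law is a product law on a finite alphabet. *)
Lemma finite_halfdev_bound (n : nat) d' (T : measurableType d') (P : probability T R)
    (X : 'I_n -> T -> Hb) (e : R) :
  iid_law P mu X -> (0 < n)%N -> 0 < e -> 8 <= n%:R * e ^+ 2 ->
  let D := [set w | [exists k : 'I_K, halfdev e (X ^~ w) (pcl k)]] in
  measurable D /\
  fine (P D) <= 4 * ((2 * n).+1 ^ dd.+1)%:R *
    (1 + fine (mu (@tail_pos _ _ _ m psi lam dd))) ^+ (2 * n) *
    expR (- (n%:R * e ^+ 2 / 80)).
Proof.
move=> iidX n0 e0 ne.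
pose S : finType := ({ffun 'I_K -> bool} * bool)%type.
pose q (s : S) := fine (mu [set x | subclass_code x = s]).
have q0 s : 0 <= q s by rewrite fine_ge0.
have sq (B : pred S) : fine (mu [set x | B (subclass_code x)]) = \sum_s q s * (B s)%:R.
  rewrite probability_fin_partition; last exact: measurable_subclass_code.
  rewrite big_mkcond; apply: eq_bigr => s _.
  by case: (B s); rewrite ?mulr1 ?mulr0.
have q1 : \sum_s q s = 1.
  have := sq xpredT; rewrite (_ : [set x | _] = setT).
    by rewrite probability_setT/= => ->; apply: eq_bigr => s _; rewrite mulr1.
  by apply/seteqP; split.
have muF (k : 'I_K) : fine (mu [set x | rathalf m psi lam (pcl k) x]) = \sum_s q s * (s.1 k)%:R.
  rewrite -(sq (fun s => s.1 k)); congr (fine (mu _)).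
  by apply/seteqP; split => x /=; rewrite ffunE.
have muB : fine (mu (@tail_pos _ _ _ m psi lam dd)) = \sum_s q s * (s.2)%:R.
  rewrite -(sq snd) tail_pos_set; congr (fine (mu _)).
  by apply/seteqP; split => x /=; [move=> h; apply/asboolP|move/asboolP].
pose cX w : {ffun 'I_n -> S} := [ffun i => subclass_code (X i w)].
pose Bad (y : {ffun 'I_n -> S}) := [exists k : 'I_K,
      let mu' := \sum_s q s * (s.1 k)%:R in
      let nu := (\sum_i ((y i).1 k)%:R) / n%:R in
      e ^+ 2 * Num.max mu' nu < (mu' - nu) ^+ 2].
have DE : [set w | [exists k : 'I_K, halfdev e (X ^~ w) (pcl k)]] = [set w | Bad (cX w)].
  apply/seteqP; suff E w : [exists k : 'I_K, halfdev e (X ^~ w) (pcl k)] = Bad (cX w).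
    by split => w /=; rewrite E.
  apply: eq_existsb => k; rewrite /halfdev muF/=.
  have -> // : \sum_i (rathalf m psi lam (pcl k) (X i w))%:R = \sum_i ((cX w i).1 k)%:R :> R.
  by apply: eq_bigr => i _; rewrite !ffunE.
have hc := iid_law_code _ _ _ _ _ _ _ _ _ _ _ _ _ _ iidX measurable_subclass_code.
split.
  rewrite DE (_ : [set _ | _] = \bigcup_(y in [set y | Bad y]) [set w | cX w = y]).
    by apply: fin_bigcup_measurable => [|y _]; [exact: finite_finset|exact: (hc y).1].
  by apply/seteqP; split => w /=; [exists (cX w)|move=> [y /= ? ->]].
rewrite DE (probability_fin_partition _ _ _ _ _ cX); last by move=> y; exact: (hc y).1.
under eq_bigr => y _ do rewrite (hc y).2.
rewrite muB; apply: (@finite_relative_vc R S n q q0 q1 _ (fun k s => s.1 k) snd) => // z zq.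
(* A letter of positive probability is the code of an actual point, so the geometric count of
   patterns applies. *)
have pt s : 0 < q s -> exists x, subclass_code x = s.
  move=> qs; apply: contrapT => /forallNP h; move: qs.
  rewrite /q (_ : [set _ | _] = set0) ?measure0 ?ltxx//.
  by apply/seteqP; split => x // /h.
have pt2 (j : 'I_n * bool) : exists x, subclass_code x = if j.2 then (z j.1).2 else (z j.1).1.
  by case: (zq j.1) => z1 z2; case: j.2; exact: pt.
have [x hx] := choice pt2.
by apply: (card_subclass_patterns n x) => i; split; [exact: (hx (i, false))|exact: (hx (i, true))].
Qed.

End FiniteSubclass.

(** The finite bound does not depend on [K], hence passes to the increasing union over an
    enumeration of rational half-spaces. This union is the measurable cover required by
    [outer_le]. *)
Lemma sup_stat_outer_bound (n dd : nat) d' (T : measurableType d') (P : probability T R)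
    (X : 'I_n -> T -> Hb) (e eps : R) :
  iid_law P mu X -> (0 < n)%N -> 0 < e -> e < eps -> 8 <= n%:R * e ^+ 2 ->
  outer_le P [set w | eps <= sup_stat mu X w]
   (4 * ((2 * n).+1 ^ dd.+1)%:R *
    (1 + fine (mu (@tail_pos _ _ _ m psi lam dd))) ^+ (2 * n) *
    expR (- (n%:R * e ^+ 2 / 80))).
Proof.
move=> iidX n0 e0 ee ne; set b := (b in outer_le _ _ b).
pose pcl k : seq rat * rat := odflt ([::], 0) (unpickle k).
pose D K := [set w | [exists k : 'I_K, halfdev e (X ^~ w) (pcl k)]].
have hD K := finite_halfdev_bound pcl K dd n d' T P X e iidX n0 e0 ne.
have mD K : measurable (D K) by exact: (hD K).1.
exists (\bigcup_K D K); split.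
- exact: bigcupT_measurable.
- move=> w /(sup_stat_halfdev _ _ _ _ _ _ _ (ltW e0) ee)[p hp].
  (* The successor makes [pickle p] the largest index allowed. *)
  exists (pickle p).+1 => //=; apply/existsP; exists ord_max => /=.
  by rewrite /pcl pickleK.
- have cv := @nondecreasing_cvg_mu _ _ _ P D mD (bigcupT_measurable _ mD) _.
  have {}cv := cv ltac:(by move=> K L KL; apply/subsetPset => w /= /existsP[k hk];
     apply/existsP; exists (widen_ord KL k)).
  rewrite -(cvg_lim _ cv)//; apply: lime_le; first by apply/cvg_ex; eexists; exact: cv.
  apply: nearW => K /=; rewrite -[P _]fineK ?fin_num_measure// lee_fin.
  exact: (hD K).2.
Qed.

End UniformDeviation.

(** * Choice of the truncation level and of the constants *)

Lemma expR1_le3 (R : realType) : expR 1 <= 3 :> R.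
Proof.
(* From [1 - 1/6 <= exp (- 1/6)]; the sixth power of 6/5 is just below 3. *)
have h : expR (6^-1) <= 6 / 5 :> R.
  have := expR_ge1Dx (- 6^-1 : R); rewrite expRN => h.
  have e0 := expR_gt0 (6^-1 : R).
  have : (1 - 6^-1) * expR (6^-1) <= 1 :> R by rewrite -ler_pdivlMr// div1r.
  by lra.
have -> : (1 : R) = 6%:R * 6^-1 by rewrite mulfV.
rewrite expRM_natl.
apply: (@le_trans _ _ ((6 / 5) ^+ 6)); last by lra.
by rewrite ler_pXn2r// ?nnegrE ?expR_ge0// divr_ge0.
Qed.

Theorem theorem3p8 (R : realType) :
  exists2 c0 : R, 0 < c0 &
  forall gamma c C : R, 0 < gamma -> 0 < c -> 0 < C ->
  exists2 C' : R, 0 < C' &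
  forall (d : measure_display) (Omega : measurableType d)
         (m : {measure set Omega -> \bar R})
         (psi : nat -> Omega -> R) (lam : nat -> R),
    ONB m psi -> eigen_seq lam ->
  forall mu : probability (Hborel m psi lam) R,
    (forall dd : nat, (1 <= dd)%N ->
       fine (mu (@tail_pos _ _ _ m psi lam dd)) <= C * expR (- c * dd%:R `^ gamma)) ->
  forall n : nat, (1 <= n)%N ->
  forall (d' : measure_display) (T : measurableType d') (P : probability T R)
         (X : 'I_n -> T -> Hborel m psi lam),
    iid_law P mu X ->
  forall eps : R, 0 < eps ->
    outer_le P [set omega | eps <= sup_stat mu X omega]
      (C' * expR (C' * ln (2 * n%:R + 1) `^ (1 + gamma^-1)
                  - c0 * n%:R * eps ^+ 2)).
Proof.
(* [320 = 80 * 4], the 4 coming from applying the deviation bound at [eps / 2]. *)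
exists 320^-1; first by rewrite invr_gt0 ltr0n.
move=> gamma c C g0 c0 C0.
pose kap := c^-1 `^ gamma^-1.
have kap0 : 0 <= kap by exact: powR_ge0.
have C4 : 4 <= 4 * expR C by have := expR_ge1Dx C; lra.
(* [4 * expR C] serves the prefactor and [kap + 2] the exponent. *)
exists (4 * expR C + kap + 2); first lra.
move=> d Omega m psi lam [psiL2 _ _] [lam0 _ _] mu tail n n0 d' T P X iidX eps e0.
set C' := 4 * expR C + kap + 2; set l := ln _; set L := l `^ _.
have b3 : 4 * expR C <= C' by rewrite /C'; lra.
have kC : kap + 2 <= C' by rewrite /C'; lra.
have nR : 1 <= n%:R :> R by rewrite ler1n.
(* As [2n + 1 >= 3 >= e]; this gives [l <= L]. *)
have l1 : 1 <= l.
  by rewrite -ler_expR lnK ?posrE; [have := expR1_le3 R; lra|lra].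
have l0 : 0 <= l by lra.
have lL : l <= L by rewrite -[leLHS](powRr1 l0) ler_powR// lerDl invr_ge0 ltW.
have L0 : 0 <= L by exact: powR_ge0.
(* If [n eps^2 < 32], the claimed bound is at least 1 and the whole space is a cover. *)
have [small|large] := ltP (n%:R * (eps / 2) ^+ 2) 8.
  exists setT; split => //; rewrite probability_setT lee_fin.
  have := expR_ge1Dx (C' * L - 320^-1 * n%:R * eps ^+ 2).
  have : 0 <= C' * L by rewrite mulr_ge0// /C'; lra.
  rewrite -mulrA; move: small; rewrite expr_div_n mulrA.
  move: (n%:R * eps ^+ 2) => x; move: (C' * L) => y.
  by rewrite /C'; nra.
(* The smallest integer above [(l / c) ^ (1 / gamma)], so that [c dd^gamma >= l] and
   [p <= C / (2n + 1)]. The successor also ensures [dd >= 1], as the tail hypothesis demands. *)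
pose dd := (Num.truncn ((l / c) `^ gamma^-1)).+1.
have lc0 : 0 <= l / c by rewrite divr_ge0// ltW.
have dd_gt : (l / c) `^ gamma^-1 < dd%:R by rewrite -truncn_lt_nat ?powR_ge0.
have dd_le : dd%:R <= (l / c) `^ gamma^-1 + 1.
  by rewrite /dd -natr1 lerD2r truncn_le ?powR_ge0.
set p := fine (mu (@tail_pos _ _ _ m psi lam dd)).
have p0 : 0 <= p by rewrite fine_ge0.
have pC : p <= C * expR (- l).
  apply: (le_trans (tail dd _)) => //; rewrite ler_pM2l// ler_expR mulNr lerN2.
  have : (l / c) `^ gamma^-1 `^ gamma <= dd%:R `^ gamma.
    by rewrite ge0_ler_powR ?nnegrE ?powR_ge0// ltW.
  rewrite -powRrM mulVf ?gt_eqF// powRr1// => h.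
  by rewrite mulrC -ler_pdivrMr.
have [A [mA EA PA]] := sup_stat_outer_bound m psi lam psiL2 lam0 mu n dd d' T P X
  (eps / 2) eps iidX n0 ltac:(lra) ltac:(lra) large.
exists A; split => //; apply: le_trans PA _; rewrite lee_fin -/p.
have el : expR l = (2 * n).+1%:R.
  by rewrite -[RHS]natr1 natrM /l lnK// posrE; lra.
(* The exponent is [(dd + 1) l], at most [l (l / c) ^ (1 / gamma) + 2 l]; the first term is
   [kap * L] and the second at most [2 L]. *)
have b1 : ((2 * n).+1 ^ dd.+1)%:R <= expR ((kap + 2) * L).
  rewrite natrX -el -expRM_natl ler_expR -[dd.+1%:R]natr1.
  have -> : (kap + 2) * L = L * kap + 2 * L by ring.
  have Lk : l * (l / c) `^ gamma^-1 = L * kap.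
    rewrite /L /kap powRM ?invr_ge0 ?(ltW c0)//.
    rewrite powRD ?(powRr1 l0) ?mulrA//.
    by apply/implyP => _; rewrite gt_eqF//; lra.
  by rewrite -Lk; nra.
(* [(1 + p)^(2n) <= exp (2 n p)], and [2 n p <= (2n + 1) p <= C]. *)
have b2 : (1 + p) ^+ (2 * n) <= expR C.
  apply: (@le_trans _ _ (expR p ^+ (2 * n))).
    by apply: lerXn2r; [rewrite nnegrE addr_ge0|exact: expR_ge0|exact: expR_ge1Dx].
  rewrite -expRM_natl ler_expR natrM.
  move: pC; rewrite expRN el ler_pdivlMr ?ltr0n// -[X in p * X]natr1 natrM.
  by move=> pn; apply: le_trans pn; rewrite mulrC ler_wpM2l// lerDl.
have -> : - (n%:R * (eps / 2) ^+ 2 / 80) = - (320^-1 * n%:R * eps ^+ 2) by field.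
rewrite expRD [leRHS]mulrA ler_wpM2r ?expR_ge0//.
have b4 : expR ((kap + 2) * L) <= expR (C' * L) by rewrite ler_expR ler_wpM2r.
have M0 := ler0n R ((2 * n).+1 ^ dd.+1).
have q0 : 0 <= (1 + p) ^+ (2 * n) by rewrite exprn_ge0// addr_ge0.
apply: (le_trans (ler_pM (mulr_ge0 (ler0n R 4) M0) q0 (ler_wpM2l (ler0n R 4) b1) b2)).
by rewrite mulrAC; apply: ler_pM b3 b4; rewrite ?mulr_ge0 ?expR_ge0.
Qed.
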